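(* Let $T=(T_1,T_2)$ be a pair of commuting bounded operators on a complex Hilbert space $H$, and assume that $T$ is Fredholm. For $k\in\mathbb{N}$ and $i=0,1,2$ let $h_i(k)=\dim H_iK(T_1^k,T_2^k;H)$. Then: (i) For each $i=0,1,2$ the limit $$e_i=e_i(T)=\lim_{k\to\infty}\frac{h_i(k)}{k^2}$$ exists and is an integer. (On the other hand, $h_i(k)$ may fail to be a polynomial for large $k$: for each $i\in\{0,1,2\}$ there is a Fredholm pair for which $h_i(k)$ does not agree with a polynomial in $k$ for all sufficiently large $k$. Moreover each $e_i$ can be strictly positive: for each $i\in\{0,1,2\}$ there is a Fredholm pair $T$ with $e_i(T)>0$.) (ii) $\mathrm{index}(T_1,T_2)=e_2-e_1+e_0$. (iii) $e_i(T_1^t,T_2^s)=t\cdot s\cdot e_i(T_1,T_2)$ for all integers $t,s\ge 0$ and $i=0,1,2$.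
   Context: For a commuting $d$-tuple $T=(T_1,\dots,T_d)$ of bounded operators on a complex Hilbert space $H$, regard $H$ as a module over $A=\mathbb{C}[z_1,\dots,z_d]$ with $z_i$ acting as $T_i$. For $x\in A$ let $K(x)$ be the complex $0\to A\xrightarrow{x}A\to 0$ (in degrees $1,0$), and let $K(T_1,\dots,T_d;H)=H\otimes_A K(z_1)\otimes_A\cdots\otimes_A K(z_d)$ be the Koszul complex, with homology groups $H_iK(T_1,\dots,T_d;H)$, $0\le i\le d$. The tuple $T$ is Fredholm if every $H_iK(T_1,\dots,T_d;H)$ is a finite-dimensional vector space; then $\mathrm{index}(T)=\sum_{i=0}^d(-1)^{d-i}\dim H_iK(T_1,\dots,T_d;H)$. For a pair, $H_2K(T;H)=\ker T_1\cap\ker T_2$ and $H_0K(T;H)=H/(T_1H+T_2H)$. The numbers $e_i(T_1^t,T_2^s)$ are defined by the same formula as in (i), applied to the pair $(T_1^t,T_2^s)$; a zeroth power is the identity operator. *)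

(* Defs.v *)
From HB Require Import structures.
From mathcomp Require Import all_boot all_order all_algebra.
From mathcomp Require Import sesquilinear complex.
From mathcomp Require Import all_classical all_reals all_analysis.

Set Implicit Arguments.
Unset Strict Implicit.
Unset Printing Implicit Defensive.

Import Order.TTheory GRing.Theory Num.Theory.
Import numFieldNormedType.Exports.

Local Open Scope classical_set_scope.
Local Open Scope ring_scope.

(* For subspaces B `<=` Z of V, [quotient_dim Z B n] says that Z / B has a
   basis of n elements: the classes of the v_i, on which every x in Z has
   unique coordinates modulo B. *)
Definition quotient_dim (K : fieldType) (V : lmodType K) (Z B : set V)
    (n : nat) : Prop :=
  exists2 v : 'I_n -> V, (forall i, Z (v i)) &
    forall x, Z x -> exists! c : 'rV[K]_n, B (x - \sum_(i < n) c 0 i *: v i).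

Section Koszul.
Context (K : fieldType) (V : lmodType K).

(* V (x) K(z_1) (x) K(z_2) is  0 -> V -> V * V -> V -> 0  in degrees 2, 1, 0,
   with these two differentials. *)
Definition koszul_d2 (T1 T2 : V -> V) (x : V) : V * V := (- T2 x, T1 x).

Definition koszul_d1 (T1 T2 : V -> V) (p : V * V) : V := T1 p.1 + T2 p.2.

Definition koszul_homology_dim (i : 'I_3) (T1 T2 : V -> V) (n : nat) : Prop :=
  match nat_of_ord i with
  | 0%N => quotient_dim [set: V] (range (koszul_d1 T1 T2)) n
  | 1%N => quotient_dim (koszul_d1 T1 T2 @^-1` [set 0])
                        (range (koszul_d2 T1 T2)) n
  | _ => quotient_dim (koszul_d2 T1 T2 @^-1` [set 0]) [set 0] n
  end.

Definition koszul_fredholm (T1 T2 : V -> V) : Prop :=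
  forall i, exists n, koszul_homology_dim i T1 T2 n.

(* For linear commuting T1 and T2 at most one n qualifies; the value is 0 by
   convention when H_i is infinite dimensional. *)
Definition koszul_dim (i : 'I_3) (T1 T2 : V -> V) : nat :=
  xget 0%N [set n | koszul_homology_dim i T1 T2 n].

Definition koszul_index (T1 T2 : V -> V) : int :=
  \sum_(i < 3) (-1) ^+ (2 - i) * (koszul_dim i T1 T2)%:Z.

Definition hpow (i : 'I_3) (T1 T2 : V -> V) (k : nat) : nat :=
  koszul_dim i (iter k T1) (iter k T2).

Definition hpow_ratio (R : realType) (i : 'I_3) (T1 T2 : V -> V) : R^nat :=
  fun k => (hpow i T1 T2 k)%:R / k%:R ^+ 2.

(* e_i; [limn] is meaningful only when the ratio converges. *)
Definition multiplicity (R : realType) (i : 'I_3) (T1 T2 : V -> V) : R :=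
  limn (hpow_ratio R i T1 T2).

Definition eventually_polynomial (R : realType) (u : nat -> nat) : Prop :=
  exists p : {poly R}, \forall k \near \oo, (u k)%:R = p.[k%:R].

End Koszul.

Definition is_hilbert (R : realType) (H : completeNormedModType R[i]) : Prop :=
  exists dot : {dot H for Num.conj}, forall x : H, `|x| ^+ 2 = dot x x.

(* The norm of H takes its values in R[i]; M%:C is M seen in R[i]. *)
Definition bounded_operator (R : realType) (H : normedModType R[i])
    (T : H -> H) : Prop :=
  exists M : R, forall x : H, `|T x| <= M%:C%C * `|x|.

Definition fredholm_pair (R : realType) (H : normedModType R[i])
    (T1 T2 : {linear H -> H}) : Prop :=
  [/\ bounded_operator T1, bounded_operator T2,
      forall x, T1 (T2 x) = T2 (T1 x) & koszul_fredholm T1 T2].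

(* Main.v *)
(* The limits are purely algebraic.  For i = 0, 2 let h(m, n) be the dimension of
   H_i of (x^m, y^n), x = T1 and y = T2.  The increment h(m+1, n) - h(m, n) is
   the dimension of a quotient of consecutive terms of a filtration; x maps these
   quotients onto (i = 0), respectively into (i = 2), each other, so the
   increments decrease, and likewise in n.  A nonnegative integer function on the
   quadrant which is nondecreasing and concave in each variable and vanishes on
   the axes is e m n + O(m + n) for some integer e.  For i = 1 one uses that the
   index of (x^m, y^n) is m n index(x, y): the Koszul complex identifies the index
   of (x, y) with the index of x on ker y minus its index on coker y, and the
   index of a single operator is additive under composition.
   All examples are shifts of the basis of l2(nat) and their adjoints: the
   coordinate shifts of nat * nat for positivity, and the multiplications by the
   variables of C[X, Y] / (X^2 - Y^2) for the failure of polynomiality. *)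
From HB Require Import structures.
Require Import Defs.
From mathcomp Require Import all_boot all_order all_algebra.
From mathcomp Require Import sesquilinear complex.
From mathcomp Require Import all_classical all_reals all_analysis.
From mathcomp Require Import ring lra zify.
Set Implicit Arguments.
Unset Strict Implicit.
Unset Printing Implicit Defensive.
Import Order.TTheory GRing.Theory Num.Theory.
Import numFieldNormedType.Exports.
Local Open Scope classical_set_scope.
Local Open Scope ring_scope.

(** * Dimensions of quotients *)

(** Homology groups are handled as subquotients Z / B, each given by two subsets of one ambient
    space. The spaces belonging to different powers can then be compared by inclusion, and an
    isomorphism is a linear map of ambient spaces that behaves well modulo B. A dimension has the
    default value 0 in the infinite case. Additivity of dimensions therefore carries a finiteness
    hypothesis, and the Fredholm property of all pairs of powers is proved together with their index
    formula. The estimate is kept in two exponents for two reasons. Concavity concerns the change of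
    one exponent with the other held fixed, so it is invisible on the diagonal h_i(k). Moreover
    e_i(T_1^t, T_2^s) is the growth along (k t, k s), so one leading coefficient settles (iii) for
    all t and s. In the examples, positivity needs no dimension of any power: the index is 1 or -1,
    the e_i are nonnegative, and (ii) leaves a single term that can account for the sign. *)

Section QuotientDim.
Variable K : fieldType.

Definition submod (V : lmodType K) (Z : set V) : Prop :=
  Z 0 /\ forall a u v, Z u -> Z v -> Z (a *: u + v).

Section Submod.
Variables (V : lmodType K) (Z : set V).
Hypothesis hZ : submod Z.

Lemma submod0 : Z 0. Proof. by case: hZ. Qed.

Lemma submodD u v : Z u -> Z v -> Z (u + v).
Proof. by case: hZ => _ h zu zv; have := h 1 u v zu zv; rewrite scale1r. Qed.

Lemma submodZ a u : Z u -> Z (a *: u).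
Proof. by case: hZ => z0 h zu; have := h a u 0 zu z0; rewrite addr0. Qed.

Lemma submodN u : Z u -> Z (- u).
Proof. by move=> zu; rewrite -scaleN1r; apply: submodZ. Qed.

Lemma submodB u v : Z u -> Z v -> Z (u - v).
Proof. by move=> zu zv; apply: submodD => //; apply: submodN. Qed.

Lemma submod_sum n (u : 'I_n -> V) (c : 'rV[K]_n) :
  (forall i, Z (u i)) -> Z (\sum_(i < n) c 0 i *: u i).
Proof.
move=> zu; apply: big_ind; [exact: submod0|exact: submodD|] => i _.
by apply: submodZ.
Qed.

Lemma submodBK u v : Z (u - v) -> Z v -> Z u.
Proof. by move=> zuv zv; rewrite -(subrK v u); apply: submodD. Qed.

Lemma submodBl u v : Z (u - v) -> Z u -> Z v.
Proof. by move=> zuv zu; rewrite -(subKr u v); apply: submodB. Qed.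

Lemma submod_sym u v : Z (u - v) -> Z (v - u).
Proof. by move=> ?; rewrite -opprB; apply: submodN. Qed.

Lemma submod_trans w u v : Z (u - w) -> Z (w - v) -> Z (u - v).
Proof. by move=> uw wv; rewrite -(subrK w u) -addrA; apply: submodD. Qed.

End Submod.

Lemma submodT (V : lmodType K) : submod [set: V]. Proof. by []. Qed.

Lemma submod1 (V : lmodType K) : submod [set 0 : V].
Proof. by split=> // a u v /= -> ->; rewrite scaler0 addr0. Qed.

Lemma submodI (V : lmodType K) (A B : set V) :
  submod A -> submod B -> submod (A `&` B).
Proof.
move=> [a0 ha] [b0 hb]; split=> // a u v [au bu] [av bv].
by split; [apply: ha|apply: hb].
Qed.

Lemma submod_preimage (V W : lmodType K) (f : {linear V -> W}) (B : set W) :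
  submod B -> submod (f @^-1` B).
Proof.
move=> [b0 hb]; split=> [|a u v bu bv]; rewrite /preimage /=.
  by rewrite linear0.
by rewrite linearP; apply: hb.
Qed.

Definition img_add (V W : lmodType K) (f : V -> W) (Z : set V) (B : set W)
  : set W := [set w | exists2 z, Z z & B (w - f z)].

Lemma submod_img_add (V W : lmodType K) (f : {linear V -> W}) Z (B : set W) :
  submod Z -> submod B -> submod (img_add f Z B).
Proof.
move=> [z0 hz] hB; split=> [|a u v [z zz bz] [z' zz' bz']].
  by exists 0 => //; rewrite linear0 subr0; apply: submod0.
exists (a *: z + z'); first exact: hz.
by rewrite linearP opprD addrACA -scalerBr; case: hB => _; apply.
Qed.

Definition lincomb (V : lmodType K) n (v : 'I_n -> V) (c : 'rV[K]_n) : V :=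
  \sum_(i < n) c 0 i *: v i.

Fact lincomb_linear (V : lmodType K) n (v : 'I_n -> V) : linear (lincomb v).
Proof.
move=> a c d; rewrite /lincomb scaler_sumr -big_split; apply: eq_bigr => i _.
by rewrite !mxE scalerDl scalerA.
Qed.

HB.instance Definition _ (V : lmodType K) n (v : 'I_n -> V) :=
  GRing.isLinear.Build K 'rV[K]_n V _ (lincomb v) (lincomb_linear v).

(** The middle equivalence is both well-definedness and injectivity of the map that f induces from Z
    / B to Z' / B'. *)
Definition quotient_iso (V W : lmodType K) (f : V -> W) (Z B : set V)
    (Z' B' : set W) : Prop :=
  [/\ forall z, Z z -> Z' (f z), forall z, Z z -> B' (f z) <-> B z &
      forall w, Z' w -> exists2 z, Z z & B' (w - f z)].

Section Iso.
Variables (V W : lmodType K) (f : {linear V -> W}).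
Variables (Z B : set V) (Z' B' : set W).
Hypotheses (hZ : submod Z) (hB' : submod B').
Hypothesis hf : quotient_iso f Z B Z' B'.

Lemma quotient_dim_iso n : quotient_dim Z B n -> quotient_dim Z' B' n.
Proof.
case: hf => fZ fB fs [v Zv hv]; exists (f \o v) => [i|w /fs[z Zz Bz]].
  exact: fZ.
have E (c : 'rV_n) : \sum_(i < n) c 0 i *: (f \o v) i = f (lincomb v c).
  by rewrite linear_sum; apply: eq_bigr => i _; rewrite linearZ.
have Zl c : Z (z - lincomb v c) by apply: submodB => //; apply: submod_sum.
have [c [Bc uc]] := hv z Zz; exists c; split=> [|d].
  rewrite E; apply: (submod_trans hB' Bz); rewrite -linearB.
  by apply/fB; [exact: Zl|exact: Bc].
rewrite E => Bd; apply: uc; apply/fB; first exact: Zl.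
rewrite linearB; apply: submod_trans Bd => //; exact: submod_sym.
Qed.

(** There is no linear map back between the ambient spaces, so a basis is lifted by choice. The
    images of the lifts agree with the given basis only modulo B', and [D] absorbs the
    difference. *)
Lemma quotient_dim_iso_inv n : quotient_dim Z' B' n -> quotient_dim Z B n.
Proof.
case: hf => fZ fB fs [w Zw hw].
have /choice[v hv] : forall i, exists z, Z z /\ B' (w i - f z).
  by move=> i; have [z zz bz] := fs _ (Zw i); exists z.
exists v => [i|z Zz]; first by case: (hv i).
have Zl c : Z (z - lincomb v c).
  by apply: submodB => //; apply: submod_sum => // i; case: (hv i).
have E c : B (z - lincomb v c) <-> B' (f z - lincomb w c).
  rewrite -fB // linearB.
  have D : B' (lincomb w c - f (lincomb v c)).
    rewrite /lincomb linear_sum -sumrB.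
    apply: big_ind; [exact: submod0|exact: submodD|] => i _.
    by rewrite linearZ -scalerBr; apply: submodZ => //; case: (hv i).
  split=> h; last exact: (submod_trans hB' h).
  by apply: (submod_trans hB' h); apply: submod_sym.
have [c [Bc uc]] := hw _ (fZ _ Zz); exists c; split; first exact/E.
by move=> d /E; apply: uc.
Qed.

End Iso.

(** A basis identifies Z / B with a space of row vectors, where the dimension theory of matrices is
    available. *)
Lemma quotient_iso_lincomb (V : lmodType K) (Z B : set V) n (v : 'I_n -> V) :
  submod Z -> submod B -> (forall i, Z (v i)) ->
  (forall x, Z x -> exists! c : 'rV[K]_n, B (x - \sum_(i < n) c 0 i *: v i)) ->
  quotient_iso (lincomb v) [set: 'rV[K]_n] [set 0] Z B.
Proof.
move=> hZ hB Zv hv; split=> [c _|c _|w /hv[c [Bc _]]]; last by exists c.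
  exact: submod_sum.
split=> [Bc|->]; last by rewrite linear0; apply: submod0.
have [d [_ ud]] := hv 0 (submod0 hZ).
rewrite -(ud c); last by rewrite sub0r; apply: submodN.
by apply: ud; rewrite big1 ?subr0 => [|i _]; [exact: submod0|rewrite mxE scale0r].
Qed.

Lemma quotient_dim_rV n (A : 'M[K]_n) :
  quotient_dim [set c : 'rV[K]_n | (c <= A)%MS] [set 0] (\rank A).
Proof.
exists (fun i => row i (row_base A)) => [i|c /= cA].
  by rewrite /=; apply: submx_trans (row_sub _ _) _; rewrite eq_row_base.
have /submxP[d cd] : (c <= row_base A)%MS by rewrite eq_row_base.
exists d; split=> [|d' /=]; rewrite -mulmx_sum_row; first by rewrite cd subrr.
move/subr0_eq; rewrite cd => /row_free_inj; apply; exact: row_base_free.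
Qed.

(** Among the matrices with row space inside S one of maximal rank is chosen; a vector of S outside
    its row space would increase the rank. *)
Lemma submod_rV n (S : set 'rV[K]_n) : submod S ->
  exists A : 'M[K]_n, forall c, S c <-> (c <= A)%MS.
Proof.
move=> hS.
pose P r := `[< exists2 A : 'M[K]_n, \rank A = r & forall c, (c <= A)%MS -> S c >].
have exP : exists r, P r.
  exists 0%N; apply/asboolP; exists 0; first exact: mxrank0.
  by move=> c; rewrite submx0 => /eqP ->; apply: submod0.
have ubP r : P r -> (r <= n)%N by move=> /asboolP[A <- _]; apply: rank_leq_row.
case: (ex_maxnP exP ubP) => r /asboolP[A rA sA] maxr.
exists A => c; split=> [Sc|]; last exact: sA.
have rk : (\rank (A + c)%MS <= \rank A)%N.
  rewrite rA; apply: maxr; apply/asboolP; exists (A + c)%MS => // d.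
  move=> /sub_addsmxP[[u v] /= ->]; apply: submodD => //.
    exact/sA/submxMl.
  by rewrite [v]mx11_scalar mul_scalar_mx; apply: submodZ.
by have := mxrank_leqif_sup (addsmxSl A c) => /leqifP;
   case: ifP => [|_]; rewrite ?addsmx_sub ?submx_refl //= ltnNge rk.
Qed.

(** The matrix of basis vectors is square: uniqueness of coordinates makes it row free, their
    existence makes it row full. *)
Lemma quotient_dim_rV_uniq n m :
  quotient_dim [set: 'rV[K]_n] [set 0] m -> n = m.
Proof.
case=> v _ hv; pose A := \matrix_i v i.
have E (c : 'rV_m) : \sum_(i < m) c 0 i *: v i = c *m A.
  by rewrite mulmx_sum_row; apply: eq_bigr => i _; rewrite rowK.
have rf : row_free A.
  apply/inj_row_free => c cA; have [d [_ ud]] := hv 0 I.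
  rewrite -(ud c); last by rewrite /= E cA subr0.
  by apply: ud; rewrite /= E mul0mx subr0.
have rF : row_full A.
  rewrite -sub1mx; apply/row_subP => i; have [c [Bc _]] := hv (row i 1%:M) I.
  by move/subr0_eq: Bc => ->; rewrite E submxMl.
by move: rf rF => /eqP rm /eqP rn; apply: etrans (esym rn) rm.
Qed.

Section Dim.
Variable V : lmodType K.
Implicit Types Z M B : set V.

Lemma quotient_dim_uniq Z B n m : submod Z -> submod B ->
  quotient_dim Z B n -> quotient_dim Z B m -> n = m.
Proof.
move=> hZ hB [v Zv hv] hm; apply: quotient_dim_rV_uniq.
by apply: quotient_dim_iso_inv hm => //; apply: quotient_iso_lincomb.
Qed.

Lemma quotient_dimD Z M B m n : submod Z -> submod M -> submod B ->
  B `<=` M -> M `<=` Z -> quotient_dim M B m -> quotient_dim Z M n ->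
  quotient_dim Z B (m + n).
Proof.
move=> hZ hM hB BM MZ [v Mv hv] [w Zw hw].
pose u (i : 'I_(m + n)) :=
  match fintype.split i with inl j => v j | inr j => w j end.
exists u => [i|]; first by rewrite /u; case: fintype.split => j; [apply: MZ|].
have E (c : 'rV_(m + n)) : \sum_(i < m + n) c 0 i *: u i =
    lincomb v (lsubmx c) + lincomb w (rsubmx c).
  rewrite big_split_ord /lincomb; congr (_ + _); apply: eq_bigr => i _.
    by rewrite mxE /u (unsplitK (inl i)).
  by rewrite mxE /u (unsplitK (inr i)).
move=> x Zx; have [d [Md ud]] := hw x Zx; have [c [Bc uc]] := hv _ Md.
exists (row_mx c d); split=> [|e].
  by rewrite E row_mxKl row_mxKr [lincomb v _ + _]addrC opprD addrA.
rewrite E [lincomb v _ + _]addrC opprD addrA => Be.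
have ed : d = rsubmx e.
  by apply: ud; apply: submodBK (BM _ Be) _ => //; apply: submod_sum.
by rewrite -[e]hsubmxK -ed; congr row_mx; apply: uc; rewrite ed.
Qed.

(** In coordinates M becomes the row space of a matrix A. Then M / B is that row space, and Z / M is
    the row space of [cokermx A], because multiplication by [cokermx A] has the row space of A as
    kernel. *)
Lemma quotient_dim_split Z M B n : submod Z -> submod M -> submod B ->
  B `<=` M -> M `<=` Z -> quotient_dim Z B n ->
  exists p q, quotient_dim M B p /\ quotient_dim Z M q.
Proof.
move=> hZ hM hB BM MZ [v Zv hv].
have [fZ fB fs] := quotient_iso_lincomb hZ hB Zv hv.
have hS := submod_preimage (lincomb v) hM.
have [A hA] := submod_rV hS.
have [rA0 rA1] : quotient_dim (lincomb v @^-1` M) [set 0] (\rank A) /\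
  quotient_dim [set: 'rV[K]_n] (lincomb v @^-1` M) (\rank (cokermx A)).
  split.
    have -> : lincomb v @^-1` M = [set c | (c <= A)%MS].
      by apply/seteqP; split=> c /hA.
    exact: quotient_dim_rV.
  apply: (@quotient_dim_iso_inv _ _ (mulmxr (cokermx A)) _ _
    [set c | (c <= cokermx A)%MS] [set 0]); last exact: quotient_dim_rV.
  - exact: submodT.
  - exact: submod1.
  split=> [c _|c _|c /submxP[d ->]]; first exact: submxMl.
    by split=> [/eqP|/hA cA]; [rewrite -submxE => /hA|apply/eqP; rewrite -submxE].
  by exists d => //=; rewrite subrr.
exists (\rank A), (\rank (cokermx A)); split.
  apply: (@quotient_dim_iso _ _ (lincomb v) _ _ _ _ hS hB _ _ rA0).
  split=> // [c _|x Mx]; first exact: fB.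
  have [c _ Bc] := fs _ (MZ _ Mx); exists c => //.
  by apply: submodBl (BM _ Bc) Mx.
apply: (@quotient_dim_iso _ _ (lincomb v) _ _ _ _ _ hM _ _ rA1) => //.
split=> // x Zx; have [c _ Bc] := fs _ Zx; exists c => //; exact: BM.
Qed.

End Dim.

(** In a concrete degree [koszul_dim] is convertible to a [qdim], and the Fredholm condition to a
    [qfin], so the results below apply to homology without rewriting. *)
Definition qfin (V : lmodType K) (Z B : set V) := exists n, quotient_dim Z B n.
Definition qdim (V : lmodType K) (Z B : set V) : nat :=
  xget 0%N [set n | quotient_dim Z B n].

Section QDim.
Variable V : lmodType K.
Implicit Types Z M B : set V.

Lemma qdimE Z B n : submod Z -> submod B -> quotient_dim Z B n -> qdim Z B = n.
Proof.
move=> hZ hB h; rewrite /qdim; case: xgetP => [m _ hm|/(_ n)//].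
exact: quotient_dim_uniq hm h.
Qed.

Lemma qdimP Z B : submod Z -> submod B -> qfin Z B -> quotient_dim Z B (qdim Z B).
Proof. by move=> hZ hB [n h]; rewrite (qdimE hZ hB h). Qed.

Lemma quotient_dim0 Z B : submod B -> Z `<=` B -> quotient_dim Z B 0.
Proof.
move=> hB ZB; exists (fun=> 0) => [[]//|x /ZB Bx].
exists 0; split=> [|d _]; first by rewrite big_ord0 subr0.
by apply/rowP => -[].
Qed.

Lemma qfin0 Z B : submod B -> Z `<=` B -> qfin Z B.
Proof. by exists 0%N; apply: quotient_dim0. Qed.

Lemma qdim0 Z B : submod Z -> submod B -> Z `<=` B -> qdim Z B = 0%N.
Proof. by move=> hZ hB ZB; apply: qdimE => //; apply: quotient_dim0. Qed.

Lemma qfin_split Z M B : submod Z -> submod M -> submod B ->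
  B `<=` M -> M `<=` Z -> qfin Z B -> qfin M B /\ qfin Z M.
Proof.
move=> hZ hM hB BM MZ [n /(quotient_dim_split hZ hM hB BM MZ)[p [q [hp hq]]]].
by split; [exists p|exists q].
Qed.

Lemma qfin_trans Z M B : submod Z -> submod M -> submod B ->
  B `<=` M -> M `<=` Z -> qfin M B -> qfin Z M -> qfin Z B.
Proof.
move=> hZ hM hB BM MZ [p hp] [q hq]; exists (p + q)%N.
exact: (quotient_dimD hZ hM hB BM MZ).
Qed.

Lemma qdimD Z M B : submod Z -> submod M -> submod B ->
  B `<=` M -> M `<=` Z -> qfin Z B -> qdim Z B = (qdim M B + qdim Z M)%N.
Proof.
move=> hZ hM hB BM MZ h; have [h1 h2] := qfin_split hZ hM hB BM MZ h.
apply: qdimE => //; apply: (quotient_dimD hZ hM hB BM MZ); exact: qdimP.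
Qed.

End QDim.

Section IsoDim.
Variables (V W : lmodType K) (f : {linear V -> W}).
Variables (Z B : set V) (Z' B' : set W).
Hypotheses (hZ : submod Z) (hB' : submod B').

Lemma qfin_iso : quotient_iso f Z B Z' B' -> qfin Z B <-> qfin Z' B'.
Proof.
move=> hf; split=> -[n h]; exists n; first exact: (quotient_dim_iso hZ hB' hf h).
exact: (quotient_dim_iso_inv hZ hB' hf h).
Qed.

Lemma qdim_iso : quotient_iso f Z B Z' B' -> qdim Z B = qdim Z' B'.
Proof.
move=> hf; rewrite /qdim; congr xget; apply/seteqP; split=> n /= h.
  exact: (quotient_dim_iso hZ hB' hf h).
exact: (quotient_dim_iso_inv hZ hB' hf h).
Qed.

End IsoDim.

Section Compare.
Variables (V W : lmodType K) (f : {linear V -> W}).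
Variables (Z B : set V) (Z' B' : set W).
Hypotheses (hZ : submod Z) (hB : submod B) (hZ' : submod Z') (hB' : submod B').

(** Z / B is isomorphic to its image [img_add f Z B'] modulo B', a subspace of the
    finite-dimensional Z' / B'. *)
Lemma qdim_inj : (forall z, Z z -> Z' (f z)) ->
  (forall z, Z z -> B' (f z) <-> B z) -> B' `<=` Z' -> qfin Z' B' ->
  qfin Z B /\ (qdim Z B <= qdim Z' B')%N.
Proof.
move=> fZ fB BZ' fin'.
have hM := submod_img_add f hZ hB'.
have BM : B' `<=` img_add f Z B'.
  by move=> b Bb; exists 0; [exact: submod0|rewrite linear0 subr0].
have MZ : img_add f Z B' `<=` Z'.
  move=> w [z Zz Bz]; apply: (submodBK hZ' _ (fZ _ Zz)); exact: BZ'.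
have i : quotient_iso f Z B (img_add f Z B') B'.
  by split=> // z Zz; exists z => //; rewrite subrr; apply: submod0.
have [f1 f2] := qfin_split hZ' hM hB' BM MZ fin'.
split; first exact/(qfin_iso _ _ i).
by rewrite (qdim_iso hZ hB' i) (qdimD hZ' hM hB' BM MZ fin') leq_addr.
Qed.

(** Z' / B' is isomorphic to Z modulo the preimage of B' in Z, and this preimage contains B. *)
Lemma qdim_surj : (forall z, Z z -> Z' (f z)) ->
  (forall z, B z -> B' (f z)) -> B `<=` Z ->
  (forall w, Z' w -> exists2 z, Z z & B' (w - f z)) -> qfin Z B ->
  qfin Z' B' /\ (qdim Z' B' <= qdim Z B)%N.
Proof.
move=> fZ fB BZ fs fin.
have hM := submodI hZ (submod_preimage f hB').
have BM : B `<=` Z `&` f @^-1` B' by move=> b Bb; split; [apply: BZ|apply: fB].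
have MZ : Z `&` f @^-1` B' `<=` Z by move=> ? [].
have i : quotient_iso f Z (Z `&` f @^-1` B') Z' B'.
  by split=> // z Zz; split=> [//|[]].
have [f1 f2] := qfin_split hZ hM hB BM MZ fin.
split; first exact/(qfin_iso _ _ i).
by rewrite -(qdim_iso hZ hB' i) (qdimD hZ hM hB BM MZ fin) leq_addl.
Qed.

End Compare.
End QuotientDim.

(** * Index of an operator on a quotient, and Koszul index *)

Section OperatorIndex.
Variables (K : fieldType) (V : lmodType K).
Implicit Types (f g : {linear V -> V}) (Z B : set V).

(** For f preserving B and Z, with B inside Z, the kernel of the operator induced on Z / B is
    [op_ker f Z B] modulo B, and its cokernel is Z modulo [img_add f Z B]. *)
Definition op_ker (f : V -> V) Z B : set V := Z `&` f @^-1` B.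

Definition op_fredholm (f : V -> V) Z B : Prop :=
  qfin (op_ker f Z B) B /\ qfin Z (img_add f Z B).

Definition op_index (f : V -> V) Z B : int :=
  (qdim (op_ker f Z B) B)%:Z - (qdim Z (img_add f Z B))%:Z.

Definition stable (f : V -> V) Z := forall z, Z z -> Z (f z).

Section Comp.
(* Exactness of
   0 -> ker g -> ker fg -> ker f -> coker g -> coker fg -> coker f -> 0:
   N and P below are the image of ker fg in ker f and the preimage in Z of the
   image of ker f in coker g. *)
Variables (f g : {linear V -> V}) (Z B : set V).
Hypotheses (hZ : submod Z) (hB : submod B) (BZ : B `<=` Z).
Hypotheses (fZ : stable f Z) (fB : stable f B).
Hypotheses (gZ : stable g Z) (gB : stable g B).

Lemma op_comp : op_fredholm f Z B -> op_fredholm g Z B ->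
  op_fredholm (f \o g) Z B /\
  op_index (f \o g) Z B = op_index f Z B + op_index g Z B.
Proof.
move=> [fin_kf fin_if] [fin_kg fin_ig].
have hker (h : {linear V -> V}) : submod (op_ker h Z B).
  by apply: submodI => //; apply: submod_preimage.
have Bker (h : {linear V -> V}) : stable h B -> B `<=` op_ker h Z B.
  by move=> hB' b Bb; split; [apply: BZ|exact: (hB' b Bb)].
have kerZ (h : {linear V -> V}) : op_ker h Z B `<=` Z by move=> ? [].
have him (h : {linear V -> V}) : submod (img_add h Z B) by apply: submod_img_add.
have Bim (h : {linear V -> V}) : B `<=` img_add h Z B.
  by move=> b Bb; exists 0; [exact: (submod0 hZ)|rewrite linear0 subr0].
have imZ (h : {linear V -> V}) : stable h Z -> img_add h Z B `<=` Z.
  by move=> hh w [z /hh Zz /BZ Zw]; apply: submodBK Zw Zz.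
have fgB : stable (f \o g) B by move=> b /gB/fB.
have fgZ : stable (f \o g) Z by move=> b /gZ/fZ.
pose N := op_ker f Z B `&` img_add g Z B.
pose P := img_add idfun (op_ker f Z B) (img_add g Z B).
have hN : submod N by apply: submodI.
have hP : submod P by apply: submod_img_add.
have BN : B `<=` N by move=> b Bb; split; [apply: Bker|apply: Bim].
have Nk : N `<=` op_ker f Z B by move=> ? [].
have gP : img_add g Z B `<=` P.
  by move=> b Ib; exists 0; [exact: (submod0 (hker f))|rewrite /= subr0].
have PZ : P `<=` Z.
  by move=> w [z [Zz _] /(imZ _ gZ) Zw]; apply: submodBK Zw Zz.
have kgfg : op_ker g Z B `<=` op_ker (f \o g) Z B.
  by move=> z [Zz Bz]; split=> //; apply: fB.
have ifgf : img_add (f \o g) Z B `<=` img_add f Z B.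
  by move=> w [z Zz Bz]; exists (g z) => //; apply: gZ.
(* Three isomorphisms replace the exact sequence: ker fg / ker g = N / B, ker f / N = P / im g and Z
   / P = im f / im fg. Additivity along the chains through ker g, im f, N and P then makes these
   dimensions cancel in the index. *)
have i1 : quotient_iso g (op_ker (f \o g) Z B) (op_ker g Z B) N B.
  split=> [z [Zz Bz]|z [Zz Bz]|w [[Zw Bw] [z Zz Bz]]].
  - split; first by split=> //; apply: gZ.
    by exists z => //; rewrite subrr; exact: submod0.
  - by split=> [|[]].
  - exists z => //; split=> //=.
    by apply: (submodBl hB (u := f w)) => //; rewrite -linearB; apply: fB.
have i2 : quotient_iso idfun (op_ker f Z B) N P (img_add g Z B).
  split=> [z kz|z kz|w [z kz iz]]; last by exists z.
    by exists z => //; rewrite subrr; exact: submod0.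
  by split=> [|[]].
have i3 : quotient_iso f Z P (img_add f Z B) (img_add (f \o g) Z B).
  split=> [z Zz|z Zz|w [z Zz Bz]].
  - by exists z => //; rewrite subrr; exact: submod0.
  - split=> [[u Zu Bu]|[k [Zk Bk] [u Zu Bu]]].
      exists (z - g u); first split.
      + by apply: submodB => //; apply: gZ.
      + by rewrite /preimage /= linearB.
      + by rewrite /= subKr; exists u => //; rewrite subrr; exact: submod0.
    exists u => //=; apply: (submodBK hB _ Bk).
    by rewrite addrAC -!linearB; apply: fB.
  - by exists z => //; apply: Bim.
have [fin_N fin_kN] := qfin_split (hker f) hN hB BN Nk fin_kf.
have [fin_P fin_ZP] := qfin_split hZ hP (him g) gP PZ fin_ig.
have fin_k : qfin (op_ker (f \o g) Z B) (op_ker g Z B).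
  exact/(qfin_iso (hker _) hB i1).
have fin_i : qfin (img_add f Z B) (img_add (f \o g) Z B).
  exact/(qfin_iso hZ (him _) i3).
have fin_kfg := qfin_trans (hker _) (hker g) hB (Bker _ gB) kgfg fin_kg fin_k.
have fin_ifg := qfin_trans hZ (him f) (him _) ifgf (imZ _ fZ) fin_i fin_if.
split; first by split.
rewrite /op_index (qdimD (hker _) (hker g) hB (Bker _ gB) kgfg fin_kfg).
rewrite (qdimD hZ (him f) (him _) ifgf (imZ _ fZ) fin_ifg).
rewrite (qdimD (hker f) hN hB BN Nk fin_kf).
rewrite (qdimD hZ hP (him g) gP PZ fin_ig).
rewrite (qdim_iso (hker _) hB i1) (qdim_iso hZ (him _) i3).
rewrite (qdim_iso (hker _) (him _) i2); lia.
Qed.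

End Comp.

Fact iter_linear n f : linear (iter n f).
Proof. by elim: n => //= n IH a u v; rewrite -linearP; congr (f _); exact: IH. Qed.

HB.instance Definition _ n f :=
  GRing.isLinear.Build K V V _ (iter n f) (iter_linear n f).

Lemma stable_iter n f Z : stable f Z -> stable (iter n f) Z.
Proof. by move=> fZ; elim: n => //= n IH z /IH/fZ. Qed.

Lemma op_iter n f Z B : submod Z -> submod B -> B `<=` Z ->
  stable f Z -> stable f B -> op_fredholm f Z B ->
  op_fredholm (iter n f) Z B /\ op_index (iter n f) Z B = n%:Z * op_index f Z B.
Proof.
move=> hZ hB BZ fZ fB ff.
have hi := submod_img_add (iter 0 f) hZ hB.
have hk := submodI hZ (submod_preimage (iter 0 f) hB).
have ki : op_ker (iter 0 f) Z B `<=` B by move=> ? [].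
have ii : Z `<=` img_add (iter 0 f) Z B.
  by move=> z Zz; exists z => //=; rewrite subrr; exact: submod0.
elim: n => [|n [IHf IHi]].
  split; first by split; apply: qfin0.
  by rewrite /op_index (qdim0 hk hB ki) (qdim0 hZ hi ii) mul0r subrr.
have [h1 h2] := op_comp hZ hB BZ fZ fB (stable_iter n fZ) (stable_iter n fB) ff IHf.
split; first exact: h1.
by rewrite [LHS]h2 IHi -addn1 PoszD mulrDl mul1r addrC.
Qed.

End OperatorIndex.

(** * The Koszul complex of a commuting pair and its powers *)

Section KoszulPairs.
Variables (K : fieldType) (V : lmodType K).
Implicit Types (x y : {linear V -> V}).

Definition pair_inr (k : V) : V * V := (0, k).

Fact pair_inr_linear : linear pair_inr.
Proof. by move=> a u v; apply: injective_projections; rewrite //= scaler0 addr0. Qed.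

HB.instance Definition _ :=
  GRing.isLinear.Build K V (V * V)%type _ pair_inr pair_inr_linear.

Definition pair_swap (p : V * V) : V * V := (p.2, p.1).

Fact pair_swap_linear : linear pair_swap.
Proof. by []. Qed.

HB.instance Definition _ :=
  GRing.isLinear.Build K (V * V)%type (V * V)%type _
    pair_swap pair_swap_linear.

Fact koszul_d1_linear x y : linear (koszul_d1 x y).
Proof.
by move=> a u v; rewrite /koszul_d1 /= !linearP scalerDr addrACA.
Qed.

HB.instance Definition _ x y :=
  GRing.isLinear.Build K (V * V)%type V _ (koszul_d1 x y) (koszul_d1_linear x y).

Fact koszul_d2_linear x y : linear (koszul_d2 x y).
Proof.
by move=> a u v; apply: injective_projections; rewrite /= !linearP // opprD scalerN.
Qed.

HB.instance Definition _ x y :=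
  GRing.isLinear.Build K V (V * V)%type _ (koszul_d2 x y) (koszul_d2_linear x y).

Lemma submod_range (U W : lmodType K) (f : {linear U -> W}) : submod (range f).
Proof.
split=> [|a u v [u' _ <-] [v' _ <-]]; first by exists 0; rewrite ?linear0.
by exists (a *: u' + v'); rewrite ?linearP.
Qed.

Lemma range0 (U W : lmodType K) (f : {linear U -> W}) : range f 0.
Proof. exact: submod0 (submod_range f). Qed.

Lemma submod_ker (U W : lmodType K) (f : {linear U -> W}) :
  submod (f @^-1` [set 0]).
Proof. exact/submod_preimage/submod1. Qed.

(** Together with [koszul_ker2] this identifies H_0 with the cokernel of x on coker y and H_2 with
    the kernel of x on ker y. *)
Lemma koszul_range1 x y :
  range (koszul_d1 x y) = img_add x [set: V] (range y).
Proof.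
apply/seteqP; split=> [w [[a b] _ <-]|w [a _ [b _ yb]]].
  by exists a => //; exists b => //; rewrite /koszul_d1 /= addrC addKr.
by exists (a, b) => //; rewrite /koszul_d1 /= yb subrKC.
Qed.

Lemma koszul_ker2 x y :
  koszul_d2 x y @^-1` [set 0] = op_ker x (y @^-1` [set 0]) [set 0].
Proof.
apply/seteqP; split=> v; rewrite /koszul_d2 /op_ker /preimage /=.
  by move=> [/eqP]; rewrite oppr_eq0 => /eqP.
by case=> -> ->; rewrite oppr0.
Qed.

Section Pair.
Variables x y : {linear V -> V}.
Hypothesis xy : forall v, x (y v) = y (x v).

Lemma koszul_range2_sub :
  range (koszul_d2 x y) `<=` koszul_d1 x y @^-1` [set 0].
Proof.
by move=> _ [v _ <-]; rewrite /preimage /koszul_d1 /= linearN xy addNr.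
Qed.

(* The long exact sequence relating H_1 to the action of x on ker y and on
   coker y, cut at the classes whose first component is in the range of y. *)
Let E : set (V * V) := (koszul_d1 x y @^-1` [set 0]) `&` (fst @^-1` range y).

Lemma koszul_homology1 :
  let Z1 := koszul_d1 x y @^-1` [set 0] in
  let B1 := range (koszul_d2 x y) in
  let KY := y @^-1` [set 0] in
  [/\ submod E, B1 `<=` E, E `<=` Z1,
    quotient_iso fst Z1 E (op_ker x [set: V] (range y)) (range y) &
    quotient_iso pair_inr KY (img_add x KY [set 0]) E B1].
Proof.
move=> Z1 B1 KY; split.
- apply: submodI; first exact: submod_ker.
  exact/(submod_preimage fst)/submod_range.
- move=> p Bp; split; first exact: koszul_range2_sub.
  by case: Bp => v _ <-; exists (- v); rewrite //= linearN.
- by move=> ? [].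
- split=> [p /eqP|p Zp|v [_ [w _ yw]]].
  + rewrite addr_eq0 => /eqP Zp; split=> //; exists (- p.2) => //.
    by rewrite linearN.
  + by split=> [|[]].
  + exists (v, - w); first by rewrite /Z1 /preimage /koszul_d1 /= -yw linearN subrr.
    by rewrite /= subrr; exact: range0.
- split=> [k yk|k yk|p [Zp [u _ yu]]].
  + split; first by rewrite /preimage /koszul_d1 /= linear0 add0r.
    exact: range0.
  + split=> [[v _ [/eqP]]|[z yz /subr0_eq ->]].
      by rewrite oppr_eq0 => /eqP yv <-; exists v => //=; rewrite subrr.
    by exists z => //; rewrite /koszul_d2 yz oppr0.
  (* Subtracting the boundary of - u, which is (y u, - x u), removes the first component of p. *)
  + exists (p.2 + x u).
      by rewrite /KY /preimage /= linearD -xy yu addrC.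
    exists (- u) => //; rewrite /koszul_d2 !linearN opprK yu.
    by apply: injective_projections; rewrite /= ?subr0 // opprD addrA subrr add0r.
Qed.

(** The kernel and cokernel of x on ker y are H_2 and E modulo boundaries; those of x on coker y are
    cycles modulo E and H_0. So each side asks for the finiteness of the same pieces. *)
Lemma koszul_fredholmE (KY := y @^-1` [set 0]) (RY := range y) :
  koszul_fredholm x y <-> op_fredholm x KY [set 0] /\ op_fredholm x [set: V] RY.
Proof.
have [hE BE EZ i1 i2] := koszul_homology1.
have hRY : submod RY by apply: submod_range.
have hKY : submod KY by apply: submod_ker.
have hB1 := submod_range (koszul_d2 x y).
have hZ1 := submod_ker (koszul_d1 x y).
have iff1 := qfin_iso hZ1 hRY i1.
have iff2 := qfin_iso hKY hB1 i2.
rewrite /op_fredholm -koszul_range1 -koszul_ker2.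
split=> [h|[[h2 fin2] [fin1 h0]] [[|[|[|//]]] hi]].
- have [fE fZ] := qfin_split hZ1 hE hB1 BE EZ (h (@Ordinal 3 1 isT)).
  split; split; [exact: (h (@Ordinal 3 2 isT))|exact/iff2|exact/iff1|].
  exact: (h (@Ordinal 3 0 isT)).
- exact: h0.
- apply: (qfin_trans hZ1 hE hB1 BE EZ); [exact/iff2|exact/iff1].
- exact: h2.
Qed.

Lemma koszul_indexE (KY := y @^-1` [set 0]) (RY := range y) :
  koszul_fredholm x y ->
  koszul_index x y = op_index x KY [set 0] - op_index x [set: V] RY.
Proof.
move=> h; have [hE BE EZ i1 i2] := koszul_homology1.
have hRY : submod RY by apply: submod_range.
have hKY : submod KY by apply: submod_ker.
have hB1 := submod_range (koszul_d2 x y).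
have hZ1 := submod_ker (koszul_d1 x y).
rewrite /koszul_index !big_ord_recl big_ord0 addr0 /=.
rewrite !expr0 !expr1 expr2 mulrNN !mul1r mulN1r.
rewrite /op_index -koszul_range1 -koszul_ker2.
rewrite -(qdim_iso hZ1 hRY i1) (qdim_iso hKY hB1 i2).
have -> : koszul_dim (lift ord0 ord0) x y =
    (qdim E (range (koszul_d2 x y)) + qdim (koszul_d1 x y @^-1` [set 0%R]) E)%N.
  exact: (qdimD hZ1 hE hB1 BE EZ (h (@Ordinal 3 1 isT))).
have -> : koszul_dim ord0 x y = qdim [set: V] (range (koszul_d1 x y)) by [].
have -> : koszul_dim (lift ord0 (lift ord0 ord0)) x y =
  qdim (koszul_d2 x y @^-1` [set 0]) [set 0] by [].
by rewrite PoszD; ring.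
Qed.

Lemma koszul_swap i n : koszul_homology_dim i x y n -> koszul_homology_dim i y x n.
Proof.
case: i => -[|[|[|//]]] hi; rewrite /koszul_homology_dim /=.
- have -> // : range (koszul_d1 x y) = range (koszul_d1 y x).
  apply/seteqP; split=> _ [[a b] _ <-]; exists (b, a) => //; exact: addrC.
- apply: (@quotient_dim_iso _ _ _ pair_swap).
  + exact: submod_ker.
  + exact: submod_range.
  split=> [[a b] /= |[a b] Zab|[a b] Zab].
  + by rewrite /preimage /koszul_d1 /= addrC.
  (* Swapping the components turns the boundary of v into the boundary of - v for the swapped
     pair. *)
  + split=> -[v _ [e1 e2]]; exists (- v) => //; rewrite /koszul_d2 !linearN opprK;
    by rewrite -?e1 -?e2 ?opprK.
  + exists (b, a); first by move: Zab; rewrite /preimage /koszul_d1 /= addrC.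
    by rewrite /= subrr; exact: range0.
- have -> // : koszul_d2 x y @^-1` [set 0] = koszul_d2 y x @^-1` [set 0].
  by rewrite !koszul_ker2; apply/seteqP; split=> v [].
Qed.

End Pair.

Lemma koszul_fredholm_swap x y : (forall v, x (y v) = y (x v)) ->
  koszul_fredholm x y -> koszul_fredholm y x.
Proof. by move=> xy h i; have [n hn] := h i; exists n; apply: koszul_swap. Qed.

Lemma koszul_index_swap x y : (forall v, x (y v) = y (x v)) ->
  koszul_index x y = koszul_index y x.
Proof.
move=> xy; apply: eq_bigr => i _; congr (_ * Posz _); congr xget.
by apply/seteqP; split=> n; apply: koszul_swap.
Qed.

Lemma iter_comm m x y : (forall v, x (y v) = y (x v)) ->
  forall v, iter m x (y v) = y (iter m x v).
Proof. by move=> xy v; elim: m => //= m ->. Qed.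

(** A power of x still acts on the same spaces ker y and coker y, so the statement for a single
    operator applies to each of them. Powers of y are reached through the swap. *)
Lemma koszul_iterl m x y : (forall v, x (y v) = y (x v)) ->
  koszul_fredholm x y -> koszul_fredholm (iter m x) y /\
  koszul_index (iter m x) y = m%:Z * koszul_index x y.
Proof.
move=> xy h; have [f1 f2] := (koszul_fredholmE xy).1 h.
have xK : stable x (y @^-1` [set 0]).
  by move=> v /= yv; rewrite /preimage /= -xy yv linear0.
have xR : stable x (range y) by move=> _ [v _ <-]; exists (x v).
have x0 : stable x [set 0] by move=> _ ->; rewrite /= linear0.
have [g1 e1] := op_iter m (submod_ker y) (submod1 V) (fun v v0 =>
  eq_ind_r (fun v => y v = 0) (linear0 y) v0) xK x0 f1.
have [g2 e2] := op_iter m (submodT V) (submod_range y)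
  (fun _ _ => I) (fun _ _ => I) xR f2.
have h' : koszul_fredholm (iter m x) y.
  exact/(koszul_fredholmE (iter_comm m xy)).
split=> //; rewrite (koszul_indexE (iter_comm m xy)) // (koszul_indexE xy) //.
by rewrite mulrBr -e1 -e2.
Qed.

Lemma koszul_iter m n x y : (forall v, x (y v) = y (x v)) ->
  koszul_fredholm x y -> koszul_fredholm (iter m x) (iter n y) /\
  koszul_index (iter m x) (iter n y) = (m * n)%:Z * koszul_index x y.
Proof.
move=> xy h; have [h1 e1] := koszul_iterl m xy h.
have c := iter_comm m xy.
have c' v : y (iter m x v) = iter m x (y v) by [].
have [h2 e2] := koszul_iterl n c' (koszul_fredholm_swap c h1).
split; first exact: (koszul_fredholm_swap (iter_comm n c')).
rewrite -(koszul_index_swap (iter_comm n c')) e2 -(koszul_index_swap c) e1.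
by rewrite mulrA -PoszM mulnC.
Qed.

End KoszulPairs.

(** * Growth of the Koszul dimensions *)

Section Concave.

(** The increments form a nonincreasing sequence of natural numbers, hence are constant from the
    place where their minimum d is attained. This is the source of the integrality of the limits. *)
Lemma concave_slope (u : nat -> nat) :
  (forall m, u m <= u m.+1)%N ->
  (forall m, u m.+2 + u m <= u m.+1 + u m.+1)%N ->
  exists d N, (forall m, u m + d <= u m.+1)%N /\
    forall m, (N <= m)%N -> u m.+1 = (u m + d)%N.
Proof.
move=> mono conc; pose s m := (u m.+1 - u m)%N.
have sS m : (s m.+1 <= s m)%N.
  by rewrite /s; have := conc m; have := mono m; have := mono m.+1; lia.
have sle N m : (N <= m)%N -> (s m <= s N)%N.
  by move/subnK <-; elim: (m - N)%N => //= k; apply: leq_trans (sS _).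
have exP : exists d, `[< exists m, s m = d >].
  by exists (s 0%N); apply/asboolP; exists 0%N.
case: (ex_minnP exP) => d /asboolP[N sN] dmin; exists d, N.
have ge m : (d <= s m)%N by apply: dmin; apply/asboolP; exists m.
split=> m; first by have := ge m; have := mono m; rewrite /s; lia.
by move/sle; have := ge m; have := mono m; rewrite sN /s; lia.
Qed.

Lemma concave_linear (u : nat -> nat) :
  (forall m, u m <= u m.+1)%N ->
  (forall m, u m.+2 + u m <= u m.+1 + u m.+1)%N ->
  exists d C, forall m, (m * d <= u m <= m * d + C)%N.
Proof.
move=> mono conc; have [d [N [lo up]]] := concave_slope mono conc.
exists d, (u N) => m; apply/andP; split.
  by elim: m => // m IH; have := lo m; rewrite mulSn; lia.
have [mN|/ltnW/subnK <-] := leqP m N.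
  apply: leq_trans (leq_addl _ _); move/subnK: mN => <-.
  by elim: (N - m)%N => // k IH; apply: leq_trans IH (mono _).
elim: (m - N)%N => [|k IH]; first by rewrite leq_addl.
by rewrite addSn up ?leq_addl // mulSn; lia.
Qed.

(* For fixed n, h(., n) has an eventual slope c n; c is again nondecreasing and
   concave, and its eventual slope is the coefficient e. *)
Lemma biconcave_asymp (h : nat -> nat -> nat) :
  (forall m, h m 0 = 0)%N ->
  (forall m n, h m n <= h m.+1 n)%N -> (forall m n, h m n <= h m n.+1)%N ->
  (forall m n, h m.+2 n + h m n <= h m.+1 n + h m.+1 n)%N ->
  (forall m n, h m n.+2 + h m n <= h m n.+1 + h m n.+1)%N ->
  exists e C, forall m n,
    (e * (m * n) <= h m n <= e * (m * n) + C * (m + n + 1))%N.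
Proof.
move=> h0 monol monor concl concr.
have /choice[c hc] : forall n, exists d, exists C, forall m,
    (m * d <= h m n <= m * d + C)%N.
  by move=> n; apply: (concave_linear (u := h^~ n)).
have /choice[D hD] := hc.
(* At m = C + 1 a difference of slopes of at least 1 would already exceed the error C. *)
have lin a b C : (forall m, m * a <= m * b + C)%N -> (a <= b)%N.
  move=> H; have := H C.+1; nia.
have cmono n : (c n <= c n.+1)%N.
  apply: (lin _ _ (D n.+1)) => m.
  by have := hD n m; have := hD n.+1 m; have := monor m n; lia.
have cconc n : (c n.+2 + c n <= c n.+1 + c n.+1)%N.
  apply: (lin _ _ (D n.+1 + D n.+1)%N) => m.
  have := hD n m; have := hD n.+1 m; have := hD n.+2 m; have := concr m n.
  by rewrite !mulnDr; lia.
have [e [N [lo up]]] := concave_slope cmono cconc.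
exists e, (c N + D N + e * N + D N.+1)%N => m n; apply/andP; split.
  apply: leq_trans (_ : m * c n <= _)%N; last by have := hD n m; lia.
  rewrite mulnCA leq_mul2l; apply/orP; right.
  by elim: n => [|n IH]; [rewrite muln0|have := lo n; rewrite mulnS; lia].
have hN : (h m N <= m * c N + D N)%N by have := hD N m; lia.
have [nN|/ltnW/subnK <-] := leqP n N.
  have : (h m n <= h m N)%N.
    move/subnK: nN => <-; elim: (N - n)%N => // k IH.
    exact: leq_trans IH (monor _ _).
  nia.
set k := (n - N)%N.
(* The bound [hD] at n itself is of no use, as nothing controls D n uniformly in n. By concavity the
   increments in n beyond N are at most the one at N, which [hD] at N and N + 1 bounds. *)
have incr j : (h m (j + N).+1 <= h m (j + N) + m * e + D N.+1)%N.
  elim: j => [|j IH]; last by have := concr m (j + N)%N; rewrite addSn; lia.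
  rewrite add0n; have := hD N m; have := hD N.+1 m.
  by rewrite (up N (leqnn _)) mulnDr; lia.
have : (h m (k + N) <= h m N + k * (m * e + D N.+1))%N.
  elim: k => [|j IH]; first by rewrite mul0n addn0.
  by have := incr j; rewrite addSn mulSn; lia.
nia.
Qed.

End Concave.

Section KoszulGrowth.
Variables (K : fieldType) (V : lmodType K).
Implicit Types (x y : {linear V -> V}) (i : 'I_3).

Definition kdim i (x y : V -> V) m n : nat :=
  koszul_dim i (iter m x) (iter n y).

Lemma koszul_dim_swap i x y : (forall v, x (y v) = y (x v)) ->
  koszul_dim i x y = koszul_dim i y x.
Proof.
by move=> xy; congr xget; apply/seteqP; split=> n; apply: koszul_swap.
Qed.

Lemma iter_iter_comm m n x y : (forall v, x (y v) = y (x v)) ->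
  forall v, iter m x (iter n y v) = iter n y (iter m x v).
Proof. by move=> xy v; elim: n => //= n <-; apply: iter_comm. Qed.

Lemma kdim_swap i x y m n : (forall v, x (y v) = y (x v)) ->
  kdim i x y m n = kdim i y x n m.
Proof. by move=> xy; apply/koszul_dim_swap/iter_iter_comm. Qed.

Section Pair.
Variables x y : {linear V -> V}.
Hypotheses (xy : forall v, x (y v) = y (x v)) (fred : koszul_fredholm x y).

Let fin i m n : exists d, koszul_homology_dim i (iter m x) (iter n y) d.
Proof. by have [h _] := koszul_iter m n xy fred. Qed.

Let R m n := range (koszul_d1 (iter m x) (iter n y)).
Let Q m n := koszul_d2 (iter m x) (iter n y) @^-1` [set 0].

(* Multiplication by x maps each step of the filtration by the R m n onto the
   next one. *)
Lemma kdim0_concavel (i : 'I_3) m n : i = 0%N :> nat ->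
  [/\ kdim i x y 0 n = 0%N, (kdim i x y m n <= kdim i x y m.+1 n)%N &
   (kdim i x y m.+2 n + kdim i x y m n <=
    kdim i x y m.+1 n + kdim i x y m.+1 n)%N].
Proof.
case: i => -[] // hi _.
have E k : kdim (Ordinal hi) x y k n = qdim [set: V] (R k n) by [].
have F k : qfin [set: V] (R k n) := fin (Ordinal hi) k n.
have hR k : submod (R k n) by apply: submod_range.
have RS k : R k.+1 n `<=` R k n.
  move=> _ [[a b] _ <-]; exists (x a, b) => //.
  by rewrite /koszul_d1 /= -iterS iterSr.
have DE k := qdimD (submodT V) (hR k) (hR k.+1) (@RS k) (fun _ _ => I) (F k.+1).
have [f1 _] := qfin_split (submodT V) (hR m) (hR m.+1) (@RS m)
  (fun _ _ => I) (F m.+1).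
rewrite !E !DE; split.
- apply: qdim0 => // v _; exists (v, 0) => //=.
  by rewrite /koszul_d1 /= linear0 addr0.
- exact: leq_addl.
have xR k v : R k n v -> R k.+1 n (x v).
  move=> [[a b] _ <-]; exists (a, x b) => //.
  by rewrite /koszul_d1 /= linearD iter_comm.
(* Modulo the image of y^n, the element x^(m+1) a + y^n b is x applied to x^m a. *)
have xs w : R m.+1 n w -> exists2 z, R m n z & R m.+2 n (w - x z).
  move=> [[a b] _ <-]; exists (koszul_d1 (iter m x) (iter n y) (a, 0)).
    by exists (a, 0).
  exists (0, b) => //; rewrite /koszul_d1 /= !linear0 add0r addr0.
  by rewrite addrC addKr.
have [_] := qdim_surj (hR _) (hR _) (hR _) (xR _) (xR _) (@RS m) xs f1.
lia.
Qed.

(* Multiplication by x embeds each step of the filtration by the Q m n into the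
   previous one. *)
Lemma kdim2_concavel (i : 'I_3) m n : i = 2%N :> nat ->
  [/\ kdim i x y 0 n = 0%N, (kdim i x y m n <= kdim i x y m.+1 n)%N &
   (kdim i x y m.+2 n + kdim i x y m n <=
    kdim i x y m.+1 n + kdim i x y m.+1 n)%N].
Proof.
case: i => -[|[|[]]] // hi _.
have E k : kdim (Ordinal hi) x y k n = qdim (Q k n) [set 0] by [].
have F k : qfin (Q k n) [set 0] := fin (Ordinal hi) k n.
have hQ k : submod (Q k n) by apply: submod_ker.
have QP k v : Q k n v <-> iter n y v = 0 /\ iter k x v = 0.
  by rewrite /Q koszul_ker2.
have QS k : Q k n `<=` Q k.+1 n.
  by move=> v /QP[h1 h2]; apply/QP; rewrite iterS h2 linear0.
have Q0 k : [set 0] `<=` Q k n by move=> _ ->; apply: submod0.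
have h0 := submod1 V.
have DE k := qdimD (hQ k.+1) (hQ k) h0 (@Q0 k) (@QS k) (F k.+1).
have [_ f1] := qfin_split (hQ m.+1) (hQ m) h0 (@Q0 m) (@QS m) (F m.+1).
rewrite !E !DE; split.
- by apply: qdim0 => // v /QP[_ /= ->].
- exact: leq_addr.
have yx v : iter n y v = 0 -> iter n y (x v) = 0.
  by move=> yv; rewrite (iter_comm n (fun u => esym (xy u))) yv linear0.
have xQ v : Q m.+2 n v -> Q m.+1 n (x v).
  by move=> /QP[h1 h2]; apply/QP; split; [exact: yx|rewrite -iterSr].
have xi v : Q m.+2 n v -> Q m n (x v) <-> Q m.+1 n v.
  move=> /QP[h1 h2]; split=> /QP[h3 h4]; apply/QP; split=> //.
  - by rewrite iterSr.
  - exact: yx.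
  - by rewrite -iterSr.
have [_] := qdim_inj (hQ _) (hQ _) (hQ _) xQ xi (@QS m) f1.
by move=> le; rewrite -!addnA !leq_add2l addnC leq_add2l.
Qed.

(** This is the index formula for (x^m, y^n) solved for h_1. The degrees are given through their
    values so that it applies to [Ordinal] and to [inord] alike. *)
Lemma koszul_dim_index m n (i0 i1 i2 : 'I_3) :
  i0 = 0%N :> nat -> i1 = 1%N :> nat -> i2 = 2%N :> nat ->
  (kdim i1 x y m n)%:Z = (kdim i0 x y m n)%:Z + (kdim i2 x y m n)%:Z
                        - (m * n)%:Z * koszul_index x y.
Proof.
move=> e0 e1 e2; have [_ <-] := koszul_iter m n xy fred.
rewrite /koszul_index !big_ord_recl big_ord0 addr0 /=.
rewrite !expr0 !expr1 expr2 mulrNN !mul1r mulN1r /kdim.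
have -> : i0 = ord0 by apply: val_inj.
have -> : i1 = lift ord0 ord0 by apply: val_inj.
have -> : i2 = lift ord0 (lift ord0 ord0) by apply: val_inj.
ring.
Qed.

End Pair.

(** Concavity in the second exponent is concavity in the first for the swapped pair. In degree 1 the
    leading coefficient is e_0 + e_2 minus the index, and the errors of degrees 0 and 2 add up. *)
Lemma kdim_asymp x y i : (forall v, x (y v) = y (x v)) -> koszul_fredholm x y ->
  exists (a : int) (C : nat), forall m n,
    `|(kdim i x y m n)%:Z - a * (m * n)%:Z| <= (C * (m + n + 1))%:Z.
Proof.
move=> xy fr; have yx v := esym (xy v).
have rf := koszul_fredholm_swap xy fr.
have H (j : 'I_3) : j != 1%N :> nat -> exists (e C : nat), forall m n,
    (e * (m * n) <= kdim j x y m n <= e * (m * n) + C * (m + n + 1))%N.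
  move=> j1.
  have G x' y' : (forall v, x' (y' v) = y' (x' v)) -> koszul_fredholm x' y' ->
    forall m n, [/\ kdim j x' y' 0 n = 0%N,
     (kdim j x' y' m n <= kdim j x' y' m.+1 n)%N &
     (kdim j x' y' m.+2 n + kdim j x' y' m n <=
      kdim j x' y' m.+1 n + kdim j x' y' m.+1 n)%N].
    move=> c f m n; have : j = 0%N :> nat \/ j = 2%N :> nat.
      by case: (nat_of_ord j) j1 (ltn_ord j) => [|[|[|]]] // _ _; [left|right].
    by case=> ?; [apply: kdim0_concavel|apply: kdim2_concavel].
  have G1 := G _ _ xy fr; have G2 := G _ _ yx rf.
  apply: biconcave_asymp => [m|m n|m n|m n|m n].
  - by rewrite (kdim_swap _ m _ xy); case: (G2 0%N m).
  - by case: (G1 m n).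
  - by rewrite !(kdim_swap _ m _ xy); case: (G2 n m).
  - by case: (G1 m n).
  - by rewrite !(kdim_swap _ m _ xy); case: (G2 n m).
have [e1|ne1] := eqVneq (nat_of_ord i) 1%N; last first.
  have [e [C eC]] := H i ne1; exists e%:Z, C => m n.
  by have := eC m n; rewrite ler_norml -PoszM; lia.
have [e0 [C0 h0]] := H (@Ordinal 3 0 isT) isT.
have [e2 [C2 h2]] := H (@Ordinal 3 2 isT) isT.
exists (e0%:Z + e2%:Z - koszul_index x y), (C0 + C2)%N => m n.
rewrite (koszul_dim_index xy fr m n (i0 := @Ordinal 3 0 isT) _ e1
  (i2 := @Ordinal 3 2 isT)) //.
have := h2 m n; have := h0 m n; rewrite mulnDl.
set k0 := kdim _ _ _ _ _; set k2 := kdim _ _ _ _ _; move=> /andP[a1 a2] /andP[b1 b2].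
have -> : k0%:Z + k2%:Z - (m * n)%:Z * koszul_index x y -
    (e0%:Z + e2%:Z - koszul_index x y) * (m * n)%:Z =
    (k0%:Z - (e0 * (m * n))%:Z) + (k2%:Z - (e2 * (m * n))%:Z) by ring.
by rewrite ler_norml; apply/andP; split; lia.
Qed.

End KoszulGrowth.

(** * From the two-variable estimate to the limits e_i *)

Section Limits.
Variable R : realType.

Lemma cvg_quadratic_ratio (u : nat -> R) (a C : R) :
  (forall k, `|u k - a * k%:R ^+ 2| <= C * (k%:R + 1)) ->
  (fun k => u k / k%:R ^+ 2) @ \oo --> a.
Proof.
move=> hu.
have C0 : 0 <= C.
  by have := le_trans (normr_ge0 _) (hu 0%N); rewrite add0r mulr1.
(* For k >= 1 one has k + 1 <= 2 k, so C (k + 1) / k^2 <= 4 C / (k + 1), where 1 / (k + 1) is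
   [harmonic k]. The values s = -1 and s = 1 give the two sides of the squeeze. *)
have hh (s : R) : (fun k => a + s * (4 * C) * harmonic k) @ \oo --> a.
  rewrite -[X in _ --> X]addr0 -(mulr0 (s * (4 * C))).
  by apply: cvgD; [exact: cvg_cst|apply: cvgMl_tmp; exact: cvg_harmonic].
apply: (squeeze_cvgr _ (hh (-1)) (hh 1)); near=> k.
have k0 : (0 < k)%N by near: k; exists 1%N.
have k2 : 0 < k%:R ^+ 2 :> R by rewrite exprn_gt0 ?ltr0n.
have -> : u k / k%:R ^+ 2 = a + (u k - a * k%:R ^+ 2) / k%:R ^+ 2.
  by field; rewrite pnatr_eq0 -lt0n.
rewrite mulN1r mul1r mulNr !lerD2l -ler_norml normrM normfV (gtr0_norm k2).
rewrite ler_pdivrMr // (le_trans (hu k)) //.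
have -> : 4 * C * harmonic k * k%:R ^+ 2 = C * (4 * harmonic k * k%:R ^+ 2) by ring.
apply: ler_wpM2l => //; rewrite /harmonic mulrAC ler_pdivlMr ?ltr0n //.
have : 1 <= k%:R :> R by rewrite ler1n.
by rewrite -natr1; nra.
Unshelve. all: by end_near. Qed.

End Limits.

Section Multiplicity.
Variables (R : realType) (K : fieldType) (V : lmodType K).
Variables x y : {linear V -> V}.
Hypotheses (xy : forall v, x (y v) = y (x v)) (fred : koszul_fredholm x y).

Lemma hpow_iter i t s k :
  hpow i (iter t x) (iter s y) k = kdim i x y (k * t) (k * s).
Proof.
have E n m (f : V -> V) : iter n (iter m f) = iter (n * m) f.
  by apply/funext => v; rewrite iterM.
by rewrite /hpow /kdim !E.
Qed.

(** The same a serves all t and s: along (k t, k s) the dimension is a t s k^2 up to an error C (k t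
    + k s + 1) <= C (t + s + 1) (k + 1), also when t or s is 0. *)
Lemma cvg_hpow_ratio i : exists a : int, forall t s,
  hpow_ratio R i (iter t x) (iter s y) @ \oo --> ((a * (t * s)%:Z)%:~R : R).
Proof.
have [a [C h]] := kdim_asymp i xy fred; exists a => t s.
apply: (@cvg_quadratic_ratio _ (fun k => (hpow i (iter t x) (iter s y) k)%:R)
  _ (C * (t + s + 1))%:R) => k.
rewrite hpow_iter; have := h (k * t)%N (k * s)%N.
rewrite -(ler_int R) intr_norm !rmorphB /= !pmulrn.
have -> : (a * (k * t * (k * s))%N)%:~R = (a * (t * s)%N)%:~R * k%:R ^+ 2 :> R.
  rewrite -[k%:R]/(k%:~R) -rmorphXn /= -rmorphM; congr _%:~R.
  by rewrite !PoszM; ring.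
move/le_trans; apply; rewrite natr1 -natrM -pmulrn ler_nat; nia.
Qed.

End Multiplicity.

Section MultiplicityTheorem.
Variables (R : realType) (K : fieldType) (V : lmodType K).
Variables x y : {linear V -> V}.
Hypotheses (xy : forall v, x (y v) = y (x v)) (fred : koszul_fredholm x y).

Lemma multiplicity_cvg i : hpow_ratio R i x y @ \oo --> multiplicity R i x y.
Proof.
have [a ha] := cvg_hpow_ratio R xy fred i.
by apply: cvgP (ha 1%N 1%N).
Qed.

Lemma multiplicity_int i : multiplicity R i x y \is a Num.int.
Proof.
have [a ha] := cvg_hpow_ratio R xy fred i.
rewrite /multiplicity (cvg_lim _ (ha 1%N 1%N)) //; exact: intr_int.
Qed.

Lemma multiplicity_iter t s i :
  multiplicity R i (iter t x) (iter s y) = t%:R * s%:R * multiplicity R i x y.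
Proof.
have [a ha] := cvg_hpow_ratio R xy fred i.
rewrite /multiplicity (cvg_lim _ (ha t s)) // (cvg_lim _ (ha 1%N 1%N)) //.
by rewrite mulr1 mulrC rmorphM /= -pmulrn natrM.
Qed.

(** The relation between the limits already holds for each positive k, so the limit is that of an
    eventually constant sequence. At k = 0 the ratios are 0 by the convention for division. *)
Lemma hpow_index (k : nat) : (0 < k)%N ->
  hpow_ratio R (inord 2) x y k - hpow_ratio R (inord 1) x y k
    + hpow_ratio R (inord 0) x y k = (koszul_index x y)%:~R.
Proof.
move=> k0; have kn0 : k%:R != 0 :> R by rewrite pnatr_eq0 -lt0n.
have := @koszul_dim_index _ _ _ _ xy fred k k (inord 0) (inord 1) (inord 2).
rewrite !inordK // => /(_ erefl erefl erefl).
rewrite /hpow_ratio /hpow /kdim.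
set a1 := koszul_dim (inord 1) _ _; set a0 := koszul_dim (inord 0) _ _.
set a2 := koszul_dim (inord 2) _ _ => /(congr1 (fun z : int => z%:~R : R)).
rewrite rmorphB rmorphD rmorphM /= -!pmulrn natrM => ->.
by field.
Qed.

Lemma koszul_index_multiplicity : (koszul_index x y)%:~R =
  multiplicity R (inord 2) x y - multiplicity R (inord 1) x y
    + multiplicity R (inord 0) x y.
Proof.
have h : (fun k => hpow_ratio R (inord 2) x y k - hpow_ratio R (inord 1) x y k
    + hpow_ratio R (inord 0) x y k) @ \oo --> ((koszul_index x y)%:~R : R).
  apply: cvg_near_cst; near=> k; apply/hpow_index; near: k; by exists 1%N.
rewrite -(cvg_lim _ h) //; apply: cvg_lim => //.
apply: cvgD; last exact: multiplicity_cvg.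
by apply: cvgB; exact: multiplicity_cvg.
Unshelve. all: by end_near. Qed.

Lemma multiplicity_ge0 i : 0 <= multiplicity R i x y.
Proof.
apply: limr_ge.
  apply/cvg_ex; exists (multiplicity R i x y); exact: multiplicity_cvg.
by apply: nearW => k; rewrite divr_ge0 // exprn_ge0.
Qed.

Lemma multiplicity_eq0 i : (forall k, (0 < k)%N -> hpow i x y k = 0%N) ->
  multiplicity R i x y = 0.
Proof.
move=> h; apply: cvg_lim => //; apply: cvg_near_cst; near=> k.
by rewrite /hpow_ratio h ?mul0r //; near: k; exists 1%N.
Unshelve. all: by end_near. Qed.

Lemma hpow1E k : (hpow (inord 1) x y k)%:Z =
  (hpow (inord 0) x y k)%:Z + (hpow (inord 2) x y k)%:Z
   - (k * k)%:Z * koszul_index x y.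
Proof.
by apply: (@koszul_dim_index _ _ _ _ xy fred k k (inord 0) (inord 1) (inord 2));
  rewrite inordK.
Qed.

End MultiplicityTheorem.

(** * The Hilbert space of square summable sequences *)

Section SquareSummable.
Variable R : realType.
Local Notation re := (@complex.Re R).
Local Notation im := (@complex.Im R).
Implicit Types (z w : R[i]) (f g : nat -> R[i]).

Definition absq z : R := re z ^+ 2 + im z ^+ 2.

Lemma absq_ge0 z : 0 <= absq z.
Proof. by rewrite addr_ge0 ?sqr_ge0. Qed.

Lemma absq0 : absq 0 = 0.
Proof. by rewrite /absq /= expr0n addr0. Qed.

Lemma absq_eq0 z : absq z <= 0 -> z = 0.
Proof.
move=> z0; have /eqP : absq z = 0 by apply: le_anti; rewrite z0 absq_ge0.
case: z {z0} => a b; rewrite /absq /= paddr_eq0 ?sqr_ge0 // !sqrf_eq0.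
by case/andP=> /eqP -> /eqP ->.
Qed.

Lemma absqM z w : absq (z * w) = absq z * absq w.
Proof. by case: z w => [a b] [c d]; rewrite /absq /=; ring. Qed.

(* Optimizing in l yields the triangle inequality without Cauchy-Schwarz. *)
Lemma absqD_le (l : R) z w : 0 < l ->
  absq (z + w) <= (1 + l) * absq z + (1 + l^-1) * absq w.
Proof.
case: z w => [a b] [c d] l0; rewrite /absq /=.
have -> : (1 + l) * (a ^+ 2 + b ^+ 2) + (1 + l^-1) * (c ^+ 2 + d ^+ 2) =
    (a + c) ^+ 2 + (b + d) ^+ 2 + l^-1 * ((l * a - c) ^+ 2 + (l * b - d) ^+ 2).
  by field; rewrite gt_eqF.
rewrite lerDl; apply: mulr_ge0; first by rewrite invr_ge0 ltW.
by rewrite addr_ge0 ?sqr_ge0.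
Qed.

Definition sqsum f : nat -> R := series (absq \o f).
Definition square_summable f := exists M : R, forall n, sqsum f n <= M.
Definition sqnorm f : R := limn (sqsum f).

Lemma sqsum_ge0 f n : 0 <= sqsum f n.
Proof. by apply: sumr_ge0 => i _; apply: absq_ge0. Qed.

Lemma sqsum_homo f : {homo sqsum f : n m / (n <= m)%N >-> n <= m}.
Proof. by apply: nondecreasing_series => i _ _; apply: absq_ge0. Qed.

Lemma cvg_sqsum f : square_summable f -> cvgn (sqsum f).
Proof.
move=> [M hM]; apply: nondecreasing_is_cvgn; first exact: sqsum_homo.
by exists M => _ [n _ <-].
Qed.

Lemma sqsum_le_sqnorm f n : square_summable f -> sqsum f n <= sqnorm f.
Proof.
by move=> hf; apply: nondecreasing_cvgn_le; [exact: sqsum_homo|exact: cvg_sqsum].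
Qed.

Lemma sqnorm_le f (M : R) : (forall n, sqsum f n <= M) -> sqnorm f <= M.
Proof.
move=> hM; apply: limr_le; first by apply: cvg_sqsum; exists M.
exact: nearW.
Qed.

Lemma sqnorm_ge0 f : square_summable f -> 0 <= sqnorm f.
Proof. by move=> hf; apply: le_trans (sqsum_ge0 f 0) (sqsum_le_sqnorm _ hf). Qed.

(** Finite subfamilies in any order are allowed because reindexing by an injection, as in [pull_sum]
    and [push_sum], need not preserve initial segments. *)
Lemma sum_absq_le f (s : seq nat) : square_summable f -> uniq s ->
  \sum_(j <- s) absq (f j) <= sqnorm f.
Proof.
move=> hf us; pose M := (\max_(j <- s) j).+1.
apply: le_trans (sqsum_le_sqnorm M hf); rewrite /sqsum /series /=.
rewrite [leRHS](bigID (mem s)) /= -[X in _ <= X + _]big_filter.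
have -> : \sum_(i <- [seq i <- index_iota 0 M | i \in s]) absq (f i)
    = \sum_(j <- s) absq (f j).
  apply/perm_big/uniq_perm => [||j] //; first by rewrite filter_uniq ?iota_uniq.
  rewrite mem_filter mem_index_iota /=; have [js /=|//] := boolP (j \in s).
  by rewrite ltnS; apply: (@leq_bigmax_seq _ s xpredT id).
by rewrite lerDl sumr_ge0 // => i _; apply: absq_ge0.
Qed.

Lemma absq_le_sqnorm f i : square_summable f -> absq (f i) <= sqnorm f.
Proof. by move=> hf; have := @sum_absq_le f [:: i] hf isT; rewrite big_seq1. Qed.

Lemma sqnorm_eq0 f : square_summable f -> sqnorm f <= 0 -> f = 0.
Proof.
move=> hf f0; apply/funext => i; apply: absq_eq0.
exact: le_trans (absq_le_sqnorm i hf) f0.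
Qed.

Lemma sqsumD_le (l : R) f g n : 0 < l ->
  sqsum (f + g) n <= (1 + l) * sqsum f n + (1 + l^-1) * sqsum g n.
Proof.
move=> l0; rewrite /sqsum /series /= !mulr_sumr -big_split /=.
by apply: ler_sum => i _; apply: absqD_le.
Qed.

Lemma square_summable0 : square_summable 0.
Proof. by exists 0 => n; rewrite /sqsum /series /= big1 // => i _; apply: absq0. Qed.

Lemma square_summableD f g :
  square_summable f -> square_summable g -> square_summable (f + g).
Proof.
move=> [M hM] [N hN]; exists ((1 + 1) * M + (1 + 1^-1) * N) => n.
apply: le_trans (sqsumD_le f g n (ltr01 : 0 < 1 :> R)) _.
by rewrite invr1 lerD ?ler_wpM2l ?addr_ge0.
Qed.

Lemma sqsumZ a f n : sqsum (a *: f) n = absq a * sqsum f n.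
Proof.
rewrite /sqsum /series /= mulr_sumr; apply: eq_bigr => i _; exact: absqM.
Qed.

Lemma square_summableZ a f : square_summable f -> square_summable (a *: f).
Proof.
move=> [M hM]; exists (absq a * M) => n.
by rewrite sqsumZ ler_wpM2l ?absq_ge0.
Qed.

Lemma sqnormZ a f : square_summable f -> sqnorm (a *: f) = absq a * sqnorm f.
Proof.
move=> hf; rewrite /sqnorm (funext (sqsumZ a f)).
by apply/cvg_lim => //; apply: cvgMl_tmp; apply: cvg_sqsum.
Qed.

Lemma sqnormD_le f g : square_summable f -> square_summable g ->
  Num.sqrt (sqnorm (f + g)) <= Num.sqrt (sqnorm f) + Num.sqrt (sqnorm g).
Proof.
move=> hf hg; set a := Num.sqrt (sqnorm f); set b := Num.sqrt (sqnorm g).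
have [a0|a0] := ltP 0 a; last first.
  have -> : f = 0.
    apply: sqnorm_eq0 => //; rewrite leNgt -sqrtr_gt0 -leNgt //.
  by rewrite add0r lerDr sqrtr_ge0.
have [b0|b0] := ltP 0 b; last first.
  have -> : g = 0.
    apply: sqnorm_eq0 => //; rewrite leNgt -sqrtr_gt0 -leNgt //.
  by rewrite addr0 lerDl sqrtr_ge0.
(* With l = b / a the right side of [sqsumD_le], at sums a^2 and b^2, is exactly (a + b)^2. *)
have ab0 : 0 < b / a by rewrite divr_gt0.
rewrite -(ler_sqr (sqrtr_ge0 _)) ?nnegrE ?addr_ge0 ?sqrtr_ge0 //.
rewrite sqr_sqrtr ?sqnorm_ge0 //; last exact: square_summableD.
apply: sqnorm_le => n; apply: le_trans (sqsumD_le f g n ab0) _.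
have -> : (a + b) ^+ 2 = (1 + b / a) * a ^+ 2 + (1 + (b / a)^-1) * b ^+ 2.
  by field; rewrite !gt_eqF.
rewrite !sqr_sqrtr ?sqnorm_ge0 //; apply: lerD.
  by rewrite ler_wpM2l ?sqsum_le_sqnorm // addr_ge0 // ltW.
by rewrite ler_wpM2l ?sqsum_le_sqnorm // addr_ge0 // invr_ge0 ltW.
Qed.

(** Real and imaginary parts are summed separately, so that only real series occur. *)
Definition has_csum (u : nat -> R[i]) (s : R[i]) : Prop :=
  series (re \o u) @ \oo --> (re s : R) /\
  series (im \o u) @ \oo --> (im s : R).

Lemma has_csum_uniq u s t : has_csum u s -> has_csum u t -> s = t.
Proof.
case: s t => [a b] [c d] [h1 h2] [h3 h4] /=.
have <- : limn (series (re \o u)) = a by apply: cvg_lim.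
have <- : limn (series (im \o u)) = b by apply: cvg_lim.
by rewrite (cvg_lim _ h3) // (cvg_lim _ h4).
Qed.

Lemma has_csumD u v s t : has_csum u s -> has_csum v t -> has_csum (u + v) (s + t).
Proof.
case: s t => [a b] [c d] [h1 h2] [h3 h4]; split => /=.
  apply: cvg_trans (cvgD h1 h3); apply: near_eq_cvg; apply: nearW => n.
  rewrite /series /= fctE -big_split; apply: eq_bigr => i _ /=.
  by rewrite fctE; case: (u i) (v i) => [? ?] [].
apply: cvg_trans (cvgD h2 h4); apply: near_eq_cvg; apply: nearW => n.
rewrite /series /= fctE -big_split; apply: eq_bigr => i _ /=.
by rewrite fctE; case: (u i) (v i) => [? ?] [].
Qed.

Lemma has_csumZ z u s : has_csum u s -> has_csum (z *: u) (z * s).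
Proof.
case: z s => [x y] [a b] [h1 h2]; split => /=.
  apply: cvg_trans (cvgB (cvgMl_tmp (a := x) h1) (cvgMl_tmp (a := y) h2)).
  apply: near_eq_cvg; apply: nearW => n.
  rewrite /series /= !fctE !mulr_sumr -sumrB; apply: eq_bigr => i _ /=.
  by case: (u i).
apply: cvg_trans (cvgD (cvgMl_tmp (a := x) h2) (cvgMl_tmp (a := y) h1)).
apply: near_eq_cvg; apply: nearW => n.
rewrite /series /= !fctE !mulr_sumr -big_split; apply: eq_bigr => i _ /=.
by case: (u i).
Qed.

Lemma has_csumJ u s : has_csum u s -> has_csum (fun i => (u i)^*%C) (s^*%C).
Proof.
case: s => [a b] [h1 h2]; split => /=.
  apply: cvg_trans h1; apply: near_eq_cvg; apply: nearW => n.
  by apply: eq_bigr => i _ /=; case: (u i).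
apply: cvg_trans (cvgN h2); apply: near_eq_cvg; apply: nearW => n.
by rewrite /series /= fctE -sumrN; apply: eq_bigr => i _ /=; case: (u i).
Qed.

Definition dotseq f g : nat -> R[i] := fun i => f i * (g i)^*%C.

(** The real and imaginary parts of z times the conjugate of w are dominated by |z|^2 + |w|^2, which
    gives absolute convergence. *)
Lemma dotseq_cvg f g : square_summable f -> square_summable g ->
  exists s, has_csum (dotseq f g) s.
Proof.
move=> hf hg.
have dom (F : R[i] -> R) : (forall z w, `|F (z * w^*%C)| <= absq z + absq w) ->
    cvgn (series (F \o dotseq f g)).
  move=> hF; apply: normed_cvg.
  apply: (@series_le_cvg _ _ (fun i => absq (f i) + absq (g i))) => [i|i|i|].
  - exact: normr_ge0.
  - by rewrite addr_ge0 ?absq_ge0.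
  - exact: hF.
  have -> : series (fun i => absq (f i) + absq (g i)) = sqsum f + sqsum g.
    by apply/funext => n; rewrite /sqsum /series /= fctE big_split.
  by apply: is_cvgD; exact: cvg_sqsum.
have h (p q : R) : - (p ^+ 2 + q ^+ 2) <= p * q <= p ^+ 2 + q ^+ 2.
  by apply/andP; split; nra.
have cRe : cvgn (series (re \o dotseq f g)).
  apply: dom => -[a b] [c d]; rewrite /absq /= ler_norml.
  have /andP[? ?] := h a c; have /andP[? ?] := h b d; lra.
have cIm : cvgn (series (im \o dotseq f g)).
  apply: dom => -[a b] [c d]; rewrite /absq /= ler_norml.
  have /andP[? ?] := h a d; have /andP[? ?] := h b c; lra.
by exists (Complex (limn (series (re \o dotseq f g)))
  (limn (series (im \o dotseq f g)))).
Qed.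

End SquareSummable.

Section L2.
Variable R : realType.
Local Notation re := (@complex.Re R).
Local Notation im := (@complex.Im R).

Definition l2_pred : {pred (nat -> R[i])} := fun f => `[< square_summable f >].

Fact l2_submod_closed : submod_closed l2_pred.
Proof.
split=> [|a f g /asboolP hf /asboolP hg]; apply/asboolP.
  exact: square_summable0.
by apply: square_summableD => //; apply: square_summableZ.
Qed.

HB.instance Definition _ := GRing.isSubmodClosed.Build _ _ l2_pred l2_submod_closed.

Record l2 := L2 { l2val :> nat -> R[i]; l2valP : l2val \in l2_pred }.

HB.instance Definition _ := [isSub for l2val].
HB.instance Definition _ := [Choice of l2 by <:].
HB.instance Definition _ := [SubChoice_isSubLmodule of l2 by <:].

Lemma l2P (f : l2) : square_summable f.
Proof. by apply/asboolP; case: f. Qed.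

Definition l2_of (f : nat -> R[i]) (hf : square_summable f) : l2 := L2 (asboolT hf).

Lemma l2_ext (f g : l2) : (forall i, f i = g i) -> f = g.
Proof. by move=> h; apply/val_inj/funext. Qed.

Lemma l2D (f g : l2) i : (f + g) i = f i + g i. Proof. by []. Qed.
Lemma l2B (f g : l2) i : (f - g) i = f i - g i. Proof. by []. Qed.
Lemma l2Z a (f : l2) i : (a *: f) i = a * f i. Proof. by []. Qed.
Lemma l20 i : (0 : l2) i = 0. Proof. by []. Qed.

Definition l2norm (f : l2) : R[i] := (Num.sqrt (sqnorm f))%:C%C.

Fact l2normD (f g : l2) : l2norm (f + g) <= l2norm f + l2norm g.
Proof. by rewrite /l2norm -rmorphD lecR; apply: sqnormD_le; apply: l2P. Qed.

Fact l2normZ a (f : l2) : l2norm (a *: f) = `|a| * l2norm f.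
Proof.
rewrite /l2norm sqnormZ; last exact: l2P.
by rewrite sqrtrM ?absq_ge0 // rmorphM normc_def.
Qed.

Fact l2norm_eq0 (f : l2) : l2norm f = 0 -> f = 0.
Proof.
move/complexI/eqP; rewrite sqrtr_eq0 => h; apply: val_inj.
exact: sqnorm_eq0 (l2P f) h.
Qed.

HB.instance Definition _ := Lmodule_isNormed.Build R[i] l2 l2normD l2normZ l2norm_eq0.

Lemma l2_normE (f : l2) : `|f| = (Num.sqrt (sqnorm f))%:C%C.
Proof. by []. Qed.

Lemma l2_norm_le (f : l2) (e : R) : 0 <= e ->
  (`|f| <= e%:C%C) = (sqnorm f <= e ^+ 2).
Proof.
move=> e0; rewrite l2_normE lecR -ler_sqr ?nnegrE ?sqrtr_ge0 //.
by rewrite sqr_sqrtr // sqnorm_ge0 //; apply: l2P.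
Qed.

Lemma gt0_complexP (e : R[i]) : 0 < e -> exists2 r : R, 0 < r & e = r%:C%C.
Proof. by case: e => a b; rewrite ltcE /= => /andP[/eqP -> a0]; exists a. Qed.

Lemma l2_ballE (f g : l2) (e : R) :
  ball f e%:C%C g = (Num.sqrt (sqnorm (f - g : l2)) < e) :> Prop.
Proof. by rewrite -ball_normE /= l2_normE ltcR. Qed.

Lemma l2_ballP (f g : l2) (e : R) : 0 < e -> ball f e%:C%C g ->
  sqnorm (f - g : l2) <= e ^+ 2.
Proof.
rewrite l2_ballE => e0 /ltW; rewrite -lecR -l2_normE l2_norm_le //; exact: ltW.
Qed.

(** The limit g is formed coordinatewise, in real and imaginary parts. A partial sum of |f - h|^2
    involves finitely many coordinates, so its bound e^2 survives the passage from h to g; being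
    uniform in n, it bounds the norm of f - g. *)
Fact l2_complete (F : set_system l2) : ProperFilter F -> cauchy F -> cvg F.
Proof.
move=> FF /cauchyP Fc.
have Fe (e : R) : 0 < e -> exists f : l2, F (ball f e%:C%C).
  by move=> e0; apply: Fc; rewrite ltcR.
have coord (G : R[i] -> R) : (forall z w, G (z - w) = G z - G w) ->
    (forall z, G z ^+ 2 <= absq z) -> forall i, cvg ((fun h : l2 => G (h i)) @ F).
  move=> GB Gle i; apply: cauchy_cvg; apply: cauchy_exP => e e0.
  have [f Ff] := Fe e e0; exists (G (f i)).
  apply: (@filterS _ F _ (ball f e%:C%C) _ _ Ff) => h.
  rewrite l2_ballE => lt_e.
  rewrite /preimage -ball_normE /= -GB.
  apply: le_lt_trans lt_e; rewrite -sqrtr_sqr ler_wsqrtr //.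
  by apply: le_trans (Gle _) _; apply: (absq_le_sqnorm i (l2P (f - h))).
have cre i : cvg ((fun h : l2 => re (h i)) @ F).
  by apply: (coord re) => [[? ?] [? ?]|[a b]] //; rewrite lerDl sqr_ge0.
have cim i : cvg ((fun h : l2 => im (h i)) @ F).
  by apply: (coord im) => [[? ?] [? ?]|[a b]] //; rewrite lerDr sqr_ge0.
pose g i : R[i] := Complex (lim ((fun h : l2 => re (h i)) @ F))
  (lim ((fun h : l2 => im (h i)) @ F)).
have close (e : R) (f : l2) n : 0 < e -> F (ball f e%:C%C) ->
    sqsum ((f : nat -> R[i]) - g) n <= e ^+ 2.
  move=> e0 Ff.
  have cv : (fun h : l2 => sqsum ((f : nat -> R[i]) - (h : nat -> R[i])) n) @ F
      --> (sqsum ((f : nat -> R[i]) - g) n : R).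
    apply: cvg_big => [|i _]; first exact: add_continuous.
    have cr : (fun h : l2 => re (f i) - re (h i)) @ F --> (re (f i) - re (g i) : R).
      by apply: cvgB; [exact: cvg_cst|exact: cre].
    have ci : (fun h : l2 => im (f i) - im (h i)) @ F --> (im (f i) - im (g i) : R).
      by apply: cvgB; [exact: cvg_cst|exact: cim].
    have absqB z w : absq (z - w) =
        (re z - re w) * (re z - re w) + (im z - im w) * (im z - im w).
      by case: z w => [? ?] [? ?]; rewrite /absq /= !expr2.
    have -> : (absq (R := R) \o ((f : nat -> R[i]) - g)) i =
        absq (f i - g i) by [].
    rewrite absqB; apply: (cvg_trans _ (cvgD (cvgM cr cr) (cvgM ci ci))).
    by apply: near_eq_cvg; apply: nearW => h; rewrite [RHS]absqB.
  apply: (cvgr_to_le cv); apply: filterS Ff => h fh.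
  by apply: le_trans (sqsum_le_sqnorm n (l2P (f - h))) _; apply: l2_ballP.
have gl2 : square_summable g.
  have [f Ff] := Fe 1 ltr01.
  have : square_summable ((f : nat -> R[i]) - g).
    by exists (1 ^+ 2) => n; apply: close.
  move=> /(square_summableZ (-1)) /(square_summableD (l2P f)).
  by rewrite scaleN1r subKr.
apply/cvg_ex; exists (l2_of gl2); apply/cvg_ballP => e /gt0_complexP[r r0 ->].
have r2 : 0 < r / 2 by rewrite divr_gt0.
have [f Ff] := Fe _ r2; apply: filterS (Ff) => h.
rewrite -!ball_normE /= => fh.
rewrite -(subrKA f) (le_lt_trans (ler_normD _ _)) //.
rewrite [r]splitr rmorphD ler_ltD // -normrN opprB l2_norm_le; last exact: ltW.
by apply: sqnorm_le => n; apply: close.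
Qed.

HB.instance Definition _ := Uniform_isComplete.Build l2 l2_complete.

Lemma l2_dotP (f g : l2) : exists s, has_csum (dotseq f g) s.
Proof. by apply: dotseq_cvg; apply: l2P. Qed.

Definition l2dot (f g : l2) : R[i] := projT1 (cid (l2_dotP f g)).

Lemma has_csum_l2dot (f g : l2) : has_csum (dotseq f g) (l2dot f g).
Proof. exact: projT2 (cid (l2_dotP f g)). Qed.

Lemma l2dot_eq (f g : l2) s : has_csum (dotseq f g) s -> l2dot f g = s.
Proof. exact/has_csum_uniq/has_csum_l2dot. Qed.

Fact l2dot_conj (f g : l2) : l2dot f g = (l2dot g f)^*%C.
Proof.
apply: l2dot_eq; have := has_csumJ (has_csum_l2dot g f).
congr has_csum; apply/funext => i.
by rewrite /dotseq; case: (f i) (g i) => [a b] [c d] /=; congr Complex; ring.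
Qed.

Fact l2dot_linear (g : l2) : linear_for *%R (l2dot^~ g).
Proof.
move=> a f h; apply: l2dot_eq.
have := has_csumD (has_csumZ a (has_csum_l2dot f g)) (has_csum_l2dot h g).
congr has_csum; apply/funext => i.
by rewrite /dotseq l2D l2Z mulrDl -mulrA.
Qed.

Fact l2dot_bilinear : bilinear_for *%R (Num.conj \; *%R) l2dot.
Proof.
split=> [g|f]; first exact: l2dot_linear.
move=> a g h; rewrite l2dot_conj l2dot_linear (l2dot_conj f g) (l2dot_conj f h).
by rewrite /= [LHS](rmorphD conjc) /= (rmorphM conjc).
Qed.

HB.instance Definition _ := bilinear_isBilinear.Build _ _ _ _ _ _ l2dot l2dot_bilinear.

Fact l2dot_hermitian (f g : l2) : l2dot f g = (-1) ^+ false * Num.conj (l2dot g f).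
Proof. by rewrite mul1r l2dot_conj. Qed.

HB.instance Definition _ :=
  isHermitianSesquilinear.Build R[i] l2 false Num.conj l2dot l2dot_hermitian.

Lemma l2dot_normE (f : l2) : l2dot f f = `|f| ^+ 2.
Proof.
apply: l2dot_eq; rewrite l2_normE -rmorphXn /= sqr_sqrtr; last first.
  by apply: sqnorm_ge0; apply: l2P.
split=> /=; last first.
  apply: cvg_near_cst; apply: nearW => n; apply: big1 => i _ /=.
  by rewrite /dotseq; case: (f i) => a b /=; rewrite mulrN mulrC addNr.
apply: cvg_trans (cvg_sqsum (l2P f)); apply: near_eq_cvg; apply: nearW => n.
apply: eq_bigr => i _ /=; rewrite /dotseq /absq; case: (f i) => a b /=.
by rewrite mulrN opprK !expr2.
Qed.

Fact l2dot_gt0 (f : l2) : f != 0 -> 0 < l2dot f f.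
Proof. by move=> f0; rewrite l2dot_normE exprn_gt0 // normr_gt0. Qed.

HB.instance Definition _ := isDotProduct.Build R[i] l2 l2dot l2dot_gt0.

Lemma l2_hilbert : is_hilbert l2.
Proof. by exists l2dot => f; rewrite -l2dot_normE. Qed.

End L2.

(** * Isometric shifts *)

Section FredholmCriteria.
Variables (K : fieldType) (V : lmodType K).
Implicit Types (x y : {linear V -> V}).

Lemma ker0_sub y (y_inj : forall v, y v = 0 -> v = 0) :
  y @^-1` [set 0] `<=` [set 0].
Proof. by move=> v; apply: y_inj. Qed.

Section Trivial.
Variables (x : {linear V -> V}) (Z B : set V).
Hypotheses (hZ : submod Z) (hB : submod B) (ZB : Z `<=` B).

Lemma op_fredholm_trivial : op_fredholm x Z B /\ op_index x Z B = 0.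
Proof.
have hi := submod_img_add x hZ hB.
have hk := submodI hZ (submod_preimage x hB).
have kB : op_ker x Z B `<=` B by move=> v [/ZB].
have Zi : Z `<=` img_add x Z B.
  by move=> v /ZB Bv; exists 0; [exact: submod0|rewrite linear0 subr0].
split; first by split; apply: qfin0.
by rewrite /op_index (qdim0 hk hB kB) (qdim0 hZ hi Zi) subrr.
Qed.

End Trivial.

(** Since ker y = 0, only the action of x on coker y matters, and on a finite-dimensional space
    every operator is Fredholm. *)
Lemma koszul_fredholm_inj x y : (forall v, x (y v) = y (x v)) ->
  (forall v, y v = 0 -> v = 0) -> qfin [set: V] (range y) -> koszul_fredholm x y.
Proof.
move=> xy y_inj fin; apply/(koszul_fredholmE xy).
have hR := submod_range y.
split.
  exact: (op_fredholm_trivial x (submod_ker y) (submod1 V) (ker0_sub y_inj)).1.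
split.
  have hk := submodI (submodT V) (submod_preimage x hR).
  apply: (qfin_split (submodT V) hk hR _ _ fin).1 => // _ [v _ <-]; split=> //.
  by exists (x v).
have hi := submod_img_add x (submodT V) hR.
apply: (qfin_split (submodT V) hi hR _ _ fin).2 => // w Rw.
by exists 0; rewrite // linear0 subr0.
Qed.

(** Dually, coker y = 0 and x acts on the finite-dimensional ker y. *)
Lemma koszul_fredholm_surj x y : (forall v, x (y v) = y (x v)) ->
  (forall w, exists v, y v = w) -> qfin (y @^-1` [set 0]) [set 0] ->
  koszul_fredholm x y.
Proof.
move=> xy y_surj fin; apply/(koszul_fredholmE xy).
have hK := submod_ker y; have h0 := submod1 V.
have TR : [set: V] `<=` range y.
  by move=> w _; have [v <-] := y_surj w; exists v.
split; last exact: (op_fredholm_trivial x (submodT V) (submod_range y) TR).1.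
split.
  have hk := submodI hK (submod_preimage x h0).
  apply: (qfin_split hK hk h0 _ _ fin).1 => [_ ->|v []] //.
  by split; apply: submod0 => //; apply: submod_preimage.
have hi := submod_img_add x hK h0.
apply: (qfin_split hK hi h0 _ _ fin).2 => [w w0|w [z yz /subr0_eq ->]].
  by exists 0; [exact: submod0|rewrite linear0 subr0].
by rewrite /preimage /= -xy yz linear0.
Qed.

Lemma koszul_dim2_inj x y k (i : 'I_3) : i = 2%N :> nat ->
  (forall v, y v = 0 -> v = 0) -> hpow i x y k = 0%N.
Proof.
case: i => -[|[|[|]]] //= hi _ y_inj.
have -> : hpow (Ordinal hi) x y k =
  qdim (koszul_d2 (iter k x) (iter k y) @^-1` [set 0]) [set 0] by [].
apply: qdim0; [exact: submod_ker|exact: submod1|].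
rewrite koszul_ker2 => v [yv _]; elim: k v yv => [|k IH] v //=.
by move/y_inj; apply: IH.
Qed.

Lemma koszul_dim0_surj x y k (i : 'I_3) : i = 0%N :> nat ->
  (forall w, exists v, y v = w) -> hpow i x y k = 0%N.
Proof.
case: i => -[|[|[|]]] //= hi _ y_surj.
have -> : hpow (Ordinal hi) x y k =
  qdim [set: V] (range (koszul_d1 (iter k x) (iter k y))) by [].
apply: qdim0; [exact: submodT|exact: submod_range|].
have ks : forall w, exists v, iter k y v = w.
  elim: k => [|k IH] w; first by exists w.
  by have [v <-] := y_surj w; have [u <-] := IH v; exists u.
move=> w _; have [v <-] := ks w; exists (0, v) => //.
by rewrite /koszul_d1 /= linear0 add0r.
Qed.

Section DoublyCommuting.
Variables x x' y y' : {linear V -> V}.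
Hypotheses (x'x : forall v, x' (x v) = v) (y'y : forall v, y' (y v) = v).
Hypotheses (xy : forall v, x (y v) = y (x v)).
Hypotheses (x'y' : forall v, x' (y' v) = y' (x' v)).
Hypotheses (x'y : forall v, x' (y v) = y (x' v)).
Hypotheses (xy' : forall v, x (y' v) = y' (x v)).

(* The wandering subspace ker x' `&` ker y'. *)
Let D := op_ker x' (y' @^-1` [set 0]) [set 0].
Hypothesis D1 : quotient_dim D [set 0] 1.

Let hD : submod D := submodI (submod_ker y') (submod_ker x').
Let h0 := submod1 V.
Let hT := submodT V.

(** Here ker y = 0, and x is injective on coker y with cokernel D. The index of x on coker y is thus
    -1, and it enters the Koszul index with a minus sign. *)
Lemma shifts_index : koszul_fredholm x y /\ koszul_index x y = 1.
Proof.
have y_inj v : y v = 0 -> v = 0 by rewrite -{2}(y'y v) => ->; rewrite linear0.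
have K0 := ker0_sub y_inj.
have [f1 e1] := op_fredholm_trivial x (submod_ker y) h0 K0.
have hR := submod_range y.
have hi := submod_img_add x hT hR.
have hk := submodI hT (submod_preimage x hR).
have kR : op_ker x [set: V] (range y) `<=` range y.
  by move=> v [_ [w _ yw]]; exists (x' w) => //; rewrite -x'y yw x'x.
have i1 : quotient_iso idfun D [set 0] [set: V] (img_add x [set: V] (range y)).
  split=> // [v [y'v x'v]|w _].
    split=> [[a _ [b _ yb]]|->]; last exact: submod0.
    (* Applying x' gives a = - y x' b, and then applying y' gives b = x x' b, so v = - x y x' b + y
       x x' b = 0. *)
    have ev : v = x a + y b by rewrite yb subrKC.
    have ea : a = - y (x' b).
      by apply/eqP; rewrite -addr_eq0 -x'y -{1}(x'x a) -linearD -ev x'v.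
    have eb : b = x (x' b).
      apply/eqP; rewrite -subr_eq0 -(y'y (b - _)) linearB -xy addrC.
      by rewrite -linearN -[- y _]/(- y _) -ea -ev y'v.
    by rewrite ev ea linearN xy -eb addNr.
  (* The component of w in D is (1 - y y') (1 - x x') w. *)
  pose u := w - x (x' w).
    have x'u : x' u = 0 by rewrite linearB x'x subrr.
    exists (u - y (y' u)).
    split; first by rewrite /preimage /= linearB y'y subrr.
    by rewrite /preimage /= linearB x'y x'y' x'u !linear0 addr0.
  exists (x' w) => //; exists (y' u) => //.
  by rewrite /= addrAC -/u subKr.
have fin : koszul_fredholm x y.
  apply/(koszul_fredholmE xy); split=> //; split; first exact: qfin0.
  by apply/(qfin_iso hD hi i1); exists 1%N.
split=> //; rewrite (koszul_indexE xy fin) e1 /op_index (qdim0 hk hR kR).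
by rewrite -(qdim_iso hD hi i1) (qdimE hD h0 D1) sub0r opprB subr0.
Qed.

(** Now coker y' = 0, and on ker y' the operator x' is onto with kernel D. *)
Lemma coshifts_index : koszul_fredholm x' y' /\ koszul_index x' y' = 1.
Proof.
have TR : [set: V] `<=` range y' by move=> w _; exists (y w).
have [f2 e2] := op_fredholm_trivial x' hT (submod_range y') TR.
have hK := submod_ker y'.
have hi := submod_img_add x' hK h0.
have Ki : y' @^-1` [set 0] `<=` img_add x' (y' @^-1` [set 0]) [set 0].
  move=> v y'v; exists (x v); first by rewrite /preimage /= -xy' y'v linear0.
  by rewrite x'x /= subrr.
have fin : koszul_fredholm x' y'.
  apply/(koszul_fredholmE x'y'); split=> //; split; first by exists 1%N.
  exact: qfin0.
split=> //; rewrite (koszul_indexE x'y' fin) e2 /op_index.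
by rewrite (qdim0 hK hi Ki) (qdimE hD h0 D1) !subr0.
Qed.

(** Again coker y' = 0, but x is injective on ker y' with cokernel D. *)
Lemma shift_coshift_index : koszul_fredholm x y' /\ koszul_index x y' = -1.
Proof.
have TR : [set: V] `<=` range y' by move=> w _; exists (y w).
have [f2 e2] := op_fredholm_trivial x hT (submod_range y') TR.
have hK := submod_ker y'.
have hi := submod_img_add x hK h0.
have hk := submodI hK (submod_ker x).
have k0 : op_ker x (y' @^-1` [set 0]) [set 0] `<=` [set 0].
  by move=> v [_ xv]; rewrite -(x'x v) /= xv linear0.
have i1 : quotient_iso idfun D [set 0] (y' @^-1` [set 0])
    (img_add x (y' @^-1` [set 0]) [set 0]).
  split=> [v []|v [y'v x'v]|w y'w] //.
    split=> [[z y'z /subr0_eq /= ev]|->]; last exact: submod0.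
    by rewrite ev -(x'x z) -ev x'v linear0.
  have y'xw : y' (x (x' w)) = 0 by rewrite -xy' -x'y' y'w !linear0.
  exists (w - x (x' w)).
    split; first by rewrite /preimage /= linearB y'w y'xw subr0.
    by rewrite /preimage /= linearB x'x subrr.
  exists (x' w); first by rewrite /preimage /= -x'y' y'w linear0.
  by rewrite /= subKr subrr.
have fin : koszul_fredholm x y'.
  apply/(koszul_fredholmE xy'); split=> //; split; first exact: qfin0.
  by apply/(qfin_iso hD hi i1); exists 1%N.
split=> //; rewrite (koszul_indexE xy' fin) e2 /op_index (qdim0 hk h0 k0).
by rewrite -(qdim_iso hD hi i1) (qdimE hD h0 D1) sub0r subr0.
Qed.

Variable R : realType.

(** In 1 = e_2 - e_1 + e_0 the term e_2 vanishes because y is injective, and e_1 >= 0. *)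
Lemma shifts_multiplicity0 : 0 < multiplicity R (inord 0) x y.
Proof.
have [fr ind] := shifts_index.
have y_inj v : y v = 0 -> v = 0 by rewrite -{2}(y'y v) => ->; rewrite linear0.
have := koszul_index_multiplicity R xy fr; rewrite ind.
rewrite (@multiplicity_eq0 _ _ _ _ _ (inord 2)); last first.
  by move=> k _; apply: koszul_dim2_inj; rewrite ?inordK.
have := multiplicity_ge0 R xy fr (inord 1); lra.
Qed.

Lemma coshifts_multiplicity2 : 0 < multiplicity R (inord 2) x' y'.
Proof.
have [fr ind] := coshifts_index.
have := koszul_index_multiplicity R x'y' fr; rewrite ind.
rewrite (@multiplicity_eq0 _ _ _ _ _ (inord 0)); last first.
  move=> k _; apply: koszul_dim0_surj; rewrite ?inordK // => w.
  by exists (y w).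
have := multiplicity_ge0 R x'y' fr (inord 1); lra.
Qed.

Lemma shift_coshift_multiplicity1 : 0 < multiplicity R (inord 1) x y'.
Proof.
have [fr ind] := shift_coshift_index.
have := koszul_index_multiplicity R xy' fr; rewrite ind.
have := multiplicity_ge0 R xy' fr (inord 0).
have := multiplicity_ge0 R xy' fr (inord 2); lra.
Qed.

End DoublyCommuting.
End FredholmCriteria.

(** * Operators on l2 induced by injections of nat *)

Section Shifts.
Variable R : realType.
Local Notation l2 := (l2 R).

Lemma iter_injective k (s : nat -> nat) : injective s -> injective (iter k s).
Proof. by move=> si; elim: k => //= k IH i j /si/IH. Qed.

Record shift := Shift { sfun :> nat -> nat; shift_inj : injective sfun }.

Definition shift_iter k (s : shift) : shift :=
  Shift (@iter_injective k s (@shift_inj s)).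

Definition pinv (s : nat -> nat) (j : nat) : option nat :=
  if pselect (exists i, s i = j) is left h then Some (projT1 (cid h)) else None.

Lemma pinvK (s : shift) : pcancel s (pinv s).
Proof.
move=> i; rewrite /pinv; case: pselect => [h|[]]; last by exists i.
by congr Some; apply: (@shift_inj s); exact: (projT2 (cid h)).
Qed.

Lemma pinv_ocancel (s : shift) : ocancel (pinv s) s.
Proof. by move=> j; rewrite /pinv; case: pselect => //= h; exact: (projT2 (cid h)). Qed.

Lemma pinv_None (s : nat -> nat) j : ~ (exists i, s i = j) -> pinv s j = None.
Proof. by rewrite /pinv; case: pselect. Qed.

Fact pull_sum (s : shift) (f : l2) n :
  sqsum (fun i => f (s i)) n <= sqnorm f.
Proof.
rewrite /sqsum /series /= -(big_map s xpredT (fun j => absq (f j))).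
apply: sum_absq_le; first exact: l2P.
by rewrite map_inj_uniq ?iota_uniq //; apply: shift_inj.
Qed.

Fact push_sum (s : shift) (f : l2) n :
  sqsum (fun j => oapp f 0 (pinv s j)) n <= sqnorm f.
Proof.
apply: le_trans (sum_absq_le (l2P f) (_ : uniq (pmap (pinv s) (index_iota 0 n)))).
  rewrite /sqsum /series /=; elim: (index_iota 0 n) => [|j r IH].
    by rewrite !big_nil.
  rewrite big_cons /=; case: (pinv s j) => [i|] /=; first by rewrite big_cons lerD2l.
  by rewrite absq0 add0r.
by apply: (pmap_uniq (@pinv_ocancel s)); rewrite iota_uniq.
Qed.

Fact pull_summable (s : shift) (f : l2) : square_summable (fun i => f (s i)).
Proof. by exists (sqnorm f); apply: pull_sum. Qed.

Fact push_summable (s : shift) (f : l2) :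
  square_summable (fun j => oapp f 0 (pinv s j)).
Proof. by exists (sqnorm f); apply: push_sum. Qed.

(** [push s] is the isometry e_i |-> e_(s i), and [pull s] is its adjoint. *)
Definition pull (s : shift) (f : l2) : l2 := l2_of (pull_summable s f).
Definition push (s : shift) (f : l2) : l2 := l2_of (push_summable s f).
Arguments pull : simpl never.
Arguments push : simpl never.

Lemma pullE s f i : pull s f i = f (s i). Proof. by []. Qed.

Lemma pushE (s : shift) f i : push s f (s i) = f i.
Proof. by rewrite /push /= pinvK. Qed.

Lemma push_out (s : shift) f j : ~ (exists i, s i = j) -> push s f j = 0.
Proof. by move=> h; rewrite /push /= pinv_None. Qed.

Lemma push_eq (s : shift) (f g : l2) : (forall i, g (s i) = f i) ->
  (forall j, ~ (exists i, s i = j) -> g j = 0) -> push s f = g.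
Proof.
move=> h1 h2; apply: l2_ext => j; have [[i <-]|h] := pselect (exists i, s i = j).
  by rewrite pushE h1.
by rewrite h2 // push_out.
Qed.

Fact pull_linear s : linear (pull s).
Proof. by move=> a f g; apply: l2_ext. Qed.

HB.instance Definition _ s := GRing.isLinear.Build R[i] l2 l2 _ (pull s) (pull_linear s).

Fact push_linear s : linear (push s).
Proof.
move=> a f g; apply: push_eq => [i|j h]; first by rewrite l2D l2Z !pushE.
by rewrite l2D l2Z !push_out // mulr0 addr0.
Qed.

HB.instance Definition _ s := GRing.isLinear.Build R[i] l2 l2 _ (push s) (push_linear s).

Lemma contraction_bounded (T : l2 -> l2) :
  (forall f n, sqsum (T f) n <= sqnorm f) -> bounded_operator T.
Proof.
move=> h; exists 1 => f; rewrite mul1r l2_normE l2_norm_le ?sqrtr_ge0 //.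
rewrite sqr_sqrtr; last by apply: sqnorm_ge0; apply: l2P.
exact: sqnorm_le.
Qed.

Lemma pull_bounded s : bounded_operator (pull s).
Proof. exact/contraction_bounded/pull_sum. Qed.

Lemma push_bounded s : bounded_operator (push s).
Proof. exact/contraction_bounded/push_sum. Qed.

Lemma pull_push s f : pull s (push s f) = f.
Proof. by apply: l2_ext => i; rewrite pullE pushE. Qed.

(** Powers of these operators are again of the same kind, so the dimensions for k-th powers are read
    off the ranges of iterated injections. *)
Lemma push_iter k (s : shift) :
  (iter k (push s) : l2 -> l2) = push (shift_iter k s).
Proof.
apply/funext => f; apply/esym/push_eq => [i|j].
  by elim: k => // k IH; apply: etrans (pushE s _ _) IH.
elim: k j => [j h|k IH j h]; first by case: h; exists j.
have [[m mE]|h'] := pselect (exists m, s m = j); last exact: push_out.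
rewrite -mE; apply: etrans (pushE s _ _) (IH _ _) => -[i iE].
by apply: h; exists i; rewrite -mE -iE.
Qed.

Lemma pull_iter k (s : shift) :
  (iter k (pull s) : l2 -> l2) = pull (shift_iter k s).
Proof.
apply/funext => f; apply: l2_ext => i; elim: k i => // k IH i.
by rewrite iterS pullE IH !pullE /= -iterS -iterSr.
Qed.

Section Commuting.
Variables s t : shift.
Hypothesis st : forall i, s (t i) = t (s i).

Lemma pull_comm f : pull s (pull t f) = pull t (pull s f).
Proof. by apply: l2_ext => i; rewrite !pullE st. Qed.

Lemma push_comm f : push s (push t f) = push t (push s f).
Proof.
apply: push_eq => [i|j h].
  have [[k <-]|h] := pselect (exists k, t k = i); first by rewrite st !pushE.
  rewrite [RHS]push_out //.
  have [[k kE]|h'] := pselect (exists k, t k = s i); last exact: push_out.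
  rewrite -kE pushE push_out // => -[m mE]; apply: h; exists m.
  by apply: (shift_inj (s := s)); rewrite st mE.
have [[k kE]|h'] := pselect (exists k, t k = j); last exact: push_out.
rewrite -kE pushE push_out // => -[m mE]; apply: h.
by exists (t m); rewrite st mE.
Qed.

(** At j outside the range of t the left side is the value of [push t f] at s j, and the hypothesis
    keeps s j outside too. Commutation of s and t is not enough: for s = t the successor, the left
    side is f, while the right side vanishes at 0. *)
Lemma pull_push_comm f : (forall i j, s j = t i -> exists k, j = t k) ->
  pull s (push t f) = push t (pull s f).
Proof.
move=> dc; apply/esym/push_eq => [i|j h]; first by rewrite !pullE st pushE.
by rewrite pullE push_out // => -[i iE]; have [k kE] := dc i j (esym iE);
  apply: h; exists k.
Qed.

End Commuting.

Lemma delta_summable k : square_summable (fun j => (j == k)%:R : R[i]).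
Proof.
exists 1 => n; have -> : sqsum (fun j => (j == k)%:R : R[i]) n = (k < n)%:R.
  rewrite /sqsum /series /=; elim: n => [|n IH]; first by rewrite big_nil.
  rewrite big_nat_recr //= IH ltnS.
  by case: ltngtP => _ /=; rewrite /absq /= ?expr1n expr0n /= ?addr0 ?add0r.
by case: ltnP.
Qed.

Definition delta k : l2 := l2_of (delta_summable k).

Lemma l2_sum n (F : 'I_n -> l2) j : (\sum_(i < n) F i) j = \sum_(i < n) F i j.
Proof. exact: (big_morph (fun f : l2 => f j) (fun f g => l2D f g j) (l20 R j)). Qed.

Section Finite.
Variables (r : seq nat) (ur : uniq r).

Definition eval (f : l2) : 'rV[R[i]]_(size r) := \row_i f (nth 0%N r i).

Fact eval_linear : linear eval.
Proof. by move=> a f g; apply/rowP => i; rewrite !mxE. Qed.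

HB.instance Definition _ :=
  GRing.isLinear.Build R[i] l2 'rV[R[i]]_(size r) _ eval eval_linear.

Lemma eval_eq0 f : (eval f = 0) <-> (forall j, j \in r -> f j = 0).
Proof.
split=> [/rowP e j jr|h]; last by apply/rowP => i; rewrite !mxE h // mem_nth.
move: jr; rewrite -index_mem => jr; have := e (Ordinal jr).
by rewrite !mxE /= nth_index // -index_mem.
Qed.

Let lift_row (c : 'rV[R[i]]_(size r)) : l2 :=
  lincomb (fun i => delta (nth 0%N r i)) c.

Let lift_rowE c j :
  lift_row c j = \sum_(i < size r) c 0 i * (j == nth 0%N r i)%:R.
Proof. by rewrite /lift_row /lincomb l2_sum. Qed.

Let eval_lift c : eval (lift_row c) = c.
Proof.
apply/rowP => i; rewrite mxE lift_rowE (bigD1 i) //= eqxx mulr1 big1 ?addr0 //.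
move=> k ki; rewrite nth_uniq ?ltn_ord //.
by rewrite -[_ == _ :> nat]/(i == k) eq_sym (negbTE ki) mulr0.
Qed.

Let dim_row : quotient_dim [set: 'rV[R[i]]_(size r)] [set 0] (size r).
Proof.
have := quotient_dim_rV (1%:M : 'M[R[i]]_(size r)); rewrite mxrank1.
by congr quotient_dim; apply/seteqP; split=> c //= _; apply: submx1.
Qed.

Lemma quotient_dim_vanish :
  quotient_dim [set: l2] [set f | forall j, j \in r -> f j = 0] (size r).
Proof.
apply: (@quotient_dim_iso_inv _ _ _ eval _ _ _ _ _ _ _ _ dim_row) => //.
  exact: submod1.
split=> // [f _|c _]; first exact: eval_eq0.
by exists (lift_row c); rewrite //= eval_lift subrr.
Qed.

Lemma quotient_dim_supp :
  quotient_dim [set f : l2 | forall j, j \notin r -> f j = 0] [set 0] (size r).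
Proof.
apply: (@quotient_dim_iso_inv _ _ _ eval _ _ _ _ _ _ _ _ dim_row) => //.
- by split=> // a f g hf hg j jr; rewrite l2D l2Z hf // hg // mulr0 addr0.
- exact: submod1.
split=> // [f hf|c _].
  split=> [/eval_eq0 h|->]; last exact: linear0.
  by apply: l2_ext => j; have [/h|/hf] := boolP (j \in r).
exists (lift_row c) => [j jr|]; last by rewrite /= eval_lift subrr.
rewrite lift_rowE big1 // => i _; have [jE|_] := eqVneq; last by rewrite mulr0.
by rewrite jE mem_nth in jr.
Qed.

End Finite.

(** The vectors e_j with j in r represent a basis of H_0 for the two pushes and form a basis of H_2
    for the two pulls. *)
Definition coranges (s t : nat -> nat) (r : seq nat) : Prop :=
  forall j, j \in r <-> ~ (exists i, s i = j) /\ ~ (exists i, t i = j).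

Section Coranges.
Variables (s t : shift) (r : seq nat).
Hypotheses (ur : uniq r) (hr : coranges s t r).

Lemma range_push :
  range (koszul_d1 (push s) (push t)) = [set f | forall j, j \in r -> f j = 0].
Proof.
apply/seteqP; split=> [_ [[f g] _ <-] j /hr[js jt]|f fr].
  by rewrite /koszul_d1 l2D !push_out // addr0.
(* f is split into its part supported on the range of s and the rest g, which lives on the range of
   t since f vanishes on r. *)
pose g := f - push s (pull s f).
exists (pull s f, pull t g) => //; rewrite /koszul_d1 /=.
suff -> : push t (pull t g) = g by rewrite /g addrC subrK.
apply: push_eq => // j jt; rewrite /g l2B.
have [[i <-]|js] := pselect (exists i, s i = j); first by rewrite pushE pullE subrr.
by rewrite push_out // subr0 fr //; apply/hr.
Qed.

Lemma ker_pull : koszul_d2 (pull s) (pull t) @^-1` [set 0] =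
  [set f | forall j, j \notin r -> f j = 0].
Proof.
rewrite koszul_ker2; apply/seteqP; split=> [f [tf sf] j jr|f fr].
  have [[i <-]|js] := pselect (exists i, s i = j); first by rewrite -pullE sf.
  have [[i <-]|jt] := pselect (exists i, t i = j); first by rewrite -pullE tf.
  by move/negP: jr; case; apply/hr.
split; apply: l2_ext => i; rewrite pullE fr //; apply/negP => /hr[h1 h2].
  by apply: h2; exists i.
by apply: h1; exists i.
Qed.

Lemma koszul_dim0_push (i : 'I_3) : i = 0%N :> nat ->
  koszul_dim i (push s) (push t) = size r.
Proof.
case: i => -[] // hi _; apply: (@qdimE _ _ [set: l2]) => //.
  exact: submod_range.
by rewrite range_push; apply: quotient_dim_vanish.
Qed.

Lemma koszul_dim2_pull (i : 'I_3) : i = 2%N :> nat ->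
  koszul_dim i (pull s) (pull t) = size r.
Proof.
case: i => -[|[|[|]]] // hi _; apply: qdimE; [exact: submod_ker|exact: submod1|].
by rewrite ker_pull; apply: quotient_dim_supp.
Qed.

End Coranges.
End Shifts.

(** * Examples *)

Section Quadrant.
Variables (b : nat * nat -> nat) (b' : nat -> nat * nat).
Hypotheses (bK : cancel b b') (b'K : cancel b' b).

Let right n := b ((b' n).1.+1, (b' n).2).
Let up n := b ((b' n).1, (b' n).2.+1).

Fact right_inj : injective right.
Proof.
move=> m n /(can_inj bK)[e1 e2]; rewrite -[m]b'K -[n]b'K.
by rewrite [b' m]surjective_pairing e1 e2 -surjective_pairing.
Qed.

Fact up_inj : injective up.
Proof.
move=> m n /(can_inj bK)[e1 e2]; rewrite -[m]b'K -[n]b'K.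
by rewrite [b' m]surjective_pairing e1 e2 -surjective_pairing.
Qed.

Definition right_shift := Shift right_inj.
Definition up_shift := Shift up_inj.

Lemma right_up_comm i : right_shift (up_shift i) = up_shift (right_shift i).
Proof. by rewrite /= /right /up !bK. Qed.

Lemma right_up_range i j :
  right_shift j = up_shift i -> exists k, j = up_shift k.
Proof.
move=> /(can_inj bK)[_ e]; exists (b ((b' j).1, (b' i).2)).
by rewrite /= /up bK /= -e -surjective_pairing b'K.
Qed.

Lemma up_right_range i j :
  up_shift j = right_shift i -> exists k, j = right_shift k.
Proof.
move=> /(can_inj bK)[e _]; exists (b ((b' i).1, (b' j).2)).
by rewrite /= /right bK /= -e -surjective_pairing b'K.
Qed.

Lemma quadrant_coranges : coranges right_shift up_shift [:: b (0, 0)%N].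
Proof.
move=> j; rewrite inE; split=> [/eqP ->|[h1 h2]].
  by split=> -[i /(can_inj bK)].
rewrite -[j]b'K (can_eq bK); case ej : (b' j) => [[|m] [|n]] //.
- by case: h2; exists (b (0, n)%N); rewrite /= /up bK /= -ej b'K.
- by case: h1; exists (b (m, 0)%N); rewrite /= /right bK /= -ej b'K.
- by case: h1; exists (b (m, n.+1)%N); rewrite /= /right bK /= -ej b'K.
Qed.

End Quadrant.

Lemma nat_pair_bijection :
  exists (b : nat * nat -> nat) (b' : nat -> nat * nat), cancel b b' /\ cancel b' b.
Proof.
have /card_set_bijP[b bb] := card_nat2.
have [b' bK b'K] : bijective b by rewrite -setTT_bijective.
by exists b, b'.
Qed.

Section Parity.

(* Identify the basis e_0, e_1, ... of l2 with that of C[X, Y] / (X^2 - Y^2) by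
   e_(2n) = X^n and e_(2n-1) = X^(n-1) Y.  Then X acts as n |-> n + 2 and Y as
   twisted.  Since X^k = Y^k exactly for even k, the dimension of the quotient
   by (X^k, Y^k) depends on the parity of k. *)
Definition twisted n := if odd n then n + 3 else n + 1.

Fact add2_inj : injective (fun n => n + 2)%N.
Proof. by move=> m n /addIn. Qed.

Fact twisted_inj : injective twisted.
Proof. by move=> m n; rewrite /twisted; case: ifP; case: ifP; lia. Qed.

Definition add2_shift := Shift add2_inj.
Definition twisted_shift := Shift twisted_inj.

Lemma twisted_add2 i : twisted_shift (add2_shift i) = add2_shift (twisted_shift i).
Proof. by rewrite /= /twisted; case: ifP; case: ifP; lia. Qed.

Lemma iter_add2 k i : iter k (fun n => n + 2)%N i = (i + k.*2)%N.
Proof. by elim: k i => [|k IH] i /=; rewrite ?IH; lia. Qed.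

(** Two steps of [twisted] always add 4, reflecting Y^2 = X^2, so an odd k leaves one [twisted] step
    over. *)
Lemma iter_twisted k i :
  iter k twisted i = if odd k then (twisted i + k.-1.*2)%N else (i + k.*2)%N.
Proof.
elim: k => [|k IH] /=; first by lia.
rewrite IH; case: ifP => hk /=; rewrite /twisted;
  by case: (ifP (odd i)) => hi; (try case: ifP => ?); lia.
Qed.

Definition parity_size k := (k.*2 - odd k)%N.

(** For even k both iterates are addition of 2k. For odd k the iterate of [twisted] takes 2k - 1 as
    its least value, at 0, so the union of the ranges starts one lower. *)
Lemma parity_coranges k : coranges (shift_iter k twisted_shift)
  (shift_iter k add2_shift) (iota 0 (parity_size k)).
Proof.
move=> j; rewrite mem_iota /parity_size /=; split=> [h|[h1 h2]].
  split; case=> i; rewrite ?iter_add2 ?iter_twisted.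
    by case: (ifP (odd k)) h => hk h; rewrite /twisted; (try case: ifP => ?); lia.
  by lia.
apply/negPn/negP => h; have [jk|jk] := ltnP j k.*2; last first.
  by apply: h2; exists (j - k.*2)%N; rewrite iter_add2 subnK.
by apply: h1; exists 0%N; rewrite iter_twisted /twisted /=; case: ifP; lia.
Qed.

Variable R : realType.

(** For large k the polynomial 2 X - p would be 0 at even k and 1 at odd k. *)
Lemma parity_size_not_polynomial (p : {poly R}) :
  ~ (\forall k \near \oo, (parity_size k)%:R = p.[k%:R]).
Proof.
case=> N _ hN; pose q := 2%:P * 'X - p.
have qE k : (N <= k)%N -> q.[k%:R] = (odd k)%:R.
  move=> Nk; rewrite !hornerE -hN // /parity_size natrB; last first.
    by case: k {Nk} => [|[]]; lia.
  by rewrite -muln2 natrM; ring.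
have q0 : q = 0.
  pose rs := [seq ((N + i).*2)%:R : R | i <- iota 0 (size q)].
  apply: (@roots_geq_poly_eq0 _ q rs).
  - apply/allP => _ /mapP[i _ ->]; apply/rootP; rewrite qE ?odd_double //.
    by lia.
  - rewrite map_inj_uniq ?iota_uniq // => i j /eqP; rewrite eqr_nat; lia.
  - by rewrite size_map size_iota.
have := qE (N.*2.+1) _; rewrite q0 horner0 /= odd_double /= => /(_ _)/eqP.
by rewrite eq_sym oner_eq0 => h; apply: (notF (h _)); lia.
Qed.

End Parity.

Section Examples.
Variable R : realType.
Local Notation l2 := (l2 R).

Lemma ord3P (i : 'I_3) : [\/ i = inord 0, i = inord 1 | i = inord 2].
Proof.
by case: i => -[|[|[|//]]] hi; [apply: Or31|apply: Or32|apply: Or33];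
  apply: val_inj; rewrite /= inordK.
Qed.

Lemma positive_multiplicity_example (i : 'I_3) :
  exists (H : completeNormedModType R[i]) (T1 T2 : {linear H -> H}),
    [/\ is_hilbert H, fredholm_pair T1 T2 & 0 < multiplicity R i T1 T2].
Proof.
have [b [b' [bK b'K]]] := nat_pair_bijection.
pose s := right_shift bK b'K; pose t := up_shift bK b'K.
have st : forall i, s (t i) = t (s i) := right_up_comm bK b'K.
have ts j := esym (st j).
have hr : coranges s t [:: b (0, 0)%N] := quadrant_coranges bK b'K.
have x'x := @pull_push R s; have y'y := @pull_push R t.
have xy := @push_comm R _ _ st; have x'y' := @pull_comm R _ _ st.
have x'y f := @pull_push_comm R _ _ st f (@right_up_range _ _ bK b'K).
have xy' f : push s (pull t f) = pull t (push s f) :> l2.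
  apply/esym/(pull_push_comm ts); exact: (@up_right_range _ _ bK b'K).
have D1 : quotient_dim (op_ker (pull s) (pull t @^-1` [set 0]) [set 0 : l2])
    [set 0] 1.
  by rewrite -koszul_ker2 (ker_pull R hr); apply: (quotient_dim_supp R (r := [:: _])).
have hb := l2_hilbert R.
have bs := @push_bounded R s; have bt := @push_bounded R t.
have bs' := @pull_bounded R s; have bt' := @pull_bounded R t.
exists l2; have [->|->|->] := ord3P i.
- exists (push s), (push t); split=> //.
    by split=> //; exact: (shifts_index x'x y'y xy x'y' x'y D1).1.
  exact: (shifts_multiplicity0 x'x y'y xy x'y' x'y D1 R).
- exists (push s), (pull t); split=> //.
    by split=> //; exact: (shift_coshift_index x'x y'y x'y' xy' D1).1.
  exact: (shift_coshift_multiplicity1 x'x y'y x'y' xy' D1 R).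
- exists (pull s), (pull t); split=> //.
    by split=> //; exact: (coshifts_index x'x y'y x'y' xy' D1).1.
  exact: (coshifts_multiplicity2 x'x y'y x'y' xy' D1 R).
Qed.

Lemma nonpolynomial_example (i : 'I_3) :
  exists (H : completeNormedModType R[i]) (T1 T2 : {linear H -> H}),
    [/\ is_hilbert H, fredholm_pair T1 T2 &
        ~ eventually_polynomial R (hpow i T1 T2)].
Proof.
have hb := l2_hilbert R.
pose s := twisted_shift; pose t := add2_shift.
have st : forall i, s (t i) = t (s i) := twisted_add2.
(* Taking t twice lets the results on pairs describe the range of [push t] and the kernel of
   [pull t] alone. *)
have ht : coranges t t (iota 0 2).
  move=> j; rewrite mem_iota /=; split=> [j2|[h _]].
    by split; case=> i' /=; lia.
  apply/negPn/negP => j2; apply: h; exists (j - 2)%N => /=; lia.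
have xy := @push_comm R _ _ st; have x'y' := @pull_comm R _ _ st.
have y_inj (v : l2) : push t v = 0 -> v = 0.
  by move=> e; rewrite -(pull_push t v) e linear0.
have fr : koszul_fredholm (push s : l2 -> l2) (push t).
  apply: koszul_fredholm_inj => //; exists 2%N.
  have -> : range (push t) = [set f : l2 | forall j, j \in iota 0 2 -> f j = 0].
    rewrite -(range_push R ht); apply/seteqP; split=> [_ [v _ <-]|_ [[u v] _ <-]].
      by exists (v, 0) => //; rewrite /koszul_d1 /= linear0 addr0.
    by exists (u + v); rewrite /koszul_d1 ?linearD.
  exact: (@quotient_dim_vanish R (iota 0 2) (iota_uniq 0 2)).
have fr' : koszul_fredholm (pull s : l2 -> l2) (pull t).
  apply: koszul_fredholm_surj => // [w|].
    by exists (push t w); exact: pull_push.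
  exists 2%N.
  have -> : pull t @^-1` [set 0] =
      [set f : l2 | forall j, j \notin iota 0 2 -> f j = 0].
    rewrite -(ker_pull R ht) koszul_ker2; apply/seteqP; split=> [v|v []//].
    by move=> v0; split.
  exact: (@quotient_dim_supp R (iota 0 2) (iota_uniq 0 2)).
have h0 k : hpow (inord 0) (push s : l2 -> l2) (push t) k = parity_size k.
  rewrite /hpow !push_iter.
  rewrite (koszul_dim0_push R (iota_uniq _ _) (parity_coranges k)) ?size_iota //.
  by rewrite inordK.
exists l2; have [->|->|->] := ord3P i.
- exists (push s), (push t); split=> //.
    by split=> //; exact: push_bounded.
  case=> p hp; apply: (@parity_size_not_polynomial R p).
  by apply: filterS hp => k; rewrite h0.
- exists (push s), (push t); split=> //.
    by split=> //; exact: push_bounded.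
  case=> p hp; pose ind := koszul_index (push s : l2 -> l2) (push t).
  (* H_2 vanishes as [push t] is injective, so h_0(k) = h_1(k) + k^2 times the index: if h_1 were
     eventually a polynomial, h_0 would be one as well. *)
  apply: (@parity_size_not_polynomial R (p + ind%:~R *: 'X^2)).
  apply: filterS hp => k; rewrite !hornerE => <-.
  have := hpow1E xy fr k; rewrite h0.
  rewrite (@koszul_dim2_inj _ _ (push s) (push t) k (inord 2)) ?inordK //.
  move/(congr1 (fun z : int => z%:~R : R)).
  rewrite rmorphB rmorphD rmorphM /= -!pmulrn natrM => ->.
  by rewrite /ind; ring.
- exists (pull s), (pull t); split=> //.
    by split=> //; exact: pull_bounded.
  case=> p hp; apply: (@parity_size_not_polynomial R p).
  apply: filterS hp => k; rewrite /hpow !pull_iter.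
  rewrite (koszul_dim2_pull R (iota_uniq _ _) (parity_coranges k)) ?inordK //.
  by rewrite size_iota.
Qed.

End Examples.

Theorem theorem3 (R : realType) :
  (forall (H : completeNormedModType R[i]) (T1 T2 : {linear H -> H}),
     is_hilbert H -> fredholm_pair T1 T2 ->
     [/\ (forall t s : nat, koszul_fredholm (iter t T1) (iter s T2)),
         (forall i : 'I_3, cvgn (hpow_ratio R i T1 T2) /\
            multiplicity R i T1 T2 \is a Num.int),
         (koszul_index T1 T2)%:~R =
           multiplicity R (inord 2) T1 T2 - multiplicity R (inord 1) T1 T2
             + multiplicity R (inord 0) T1 T2 &
         forall (t s : nat) (i : 'I_3),
           multiplicity R i (iter t T1) (iter s T2) =
             t%:R * s%:R * multiplicity R i T1 T2])
  /\ (forall i : 'I_3,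
        exists (H : completeNormedModType R[i]) (T1 T2 : {linear H -> H}),
          [/\ is_hilbert H, fredholm_pair T1 T2 &
              ~ eventually_polynomial R (hpow i T1 T2)])
  /\ (forall i : 'I_3,
        exists (H : completeNormedModType R[i]) (T1 T2 : {linear H -> H}),
          [/\ is_hilbert H, fredholm_pair T1 T2 &
              0 < multiplicity R i T1 T2]).
Proof.
split=> [H T1 T2 _ [_ _ T12 fr]|].
  split=> [t s|i||t s i].
  - exact: (koszul_iter t s T12 fr).1.
  - split; last exact: multiplicity_int.
    by apply/cvg_ex; exists (multiplicity R i T1 T2); exact: multiplicity_cvg.
  - exact: koszul_index_multiplicity.
  - exact: multiplicity_iter.
split; [exact: nonpolynomial_example|exact: positive_multiplicity_example].
Qed.
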